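(* Let $\mu = e^{v(r)}\,dx$ be a measure on $\mathbb{R}^d$, $r=|x|$, with a convex increasing potential $v$. Then for every Borel set $A\subset\mathbb{R}^d$ the inequality $$\mu^{+}(\partial A) \ge \frac{1}{\sqrt{1+\pi^2}}\ \mu^{+}(\partial B_r)$$ holds, provided $\mu(A)=\mu(B_r)$, where $B_r=\{x\in\mathbb{R}^d: |x|\le r\}$.
   Context: For a Borel measure $\mu$ on $\mathbb{R}^d$ and a Borel set $A$, the surface measure is $\mu^{+}(\partial A)=\liminf_{\varepsilon\to 0}\frac{\mu(A^\varepsilon)-\mu(A)}{\varepsilon}$, where $A^\varepsilon$ is the $\varepsilon$-neighborhood of $A$. If $\mu$ has a continuous density $\rho$, the surface measure is represented as $\mu^{+}=\rho\cdot\mathcal{H}^{d-1}$, where $\mathcal{H}^{d-1}$ is the $(d-1)$-dimensional Hausdorff measure. *)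

(* Defs.v *)
From HB Require Import structures.
From mathcomp Require Import all_boot all_order all_algebra.
From mathcomp Require Import all_classical all_reals all_analysis.
From mathcomp Require Import measurable_realfun lra.

Set Implicit Arguments.
Unset Strict Implicit.
Unset Printing Implicit Defensive.

Import Order.TTheory GRing.Theory Num.Theory.
Import numFieldNormedType.Exports.

Local Open Scope classical_set_scope.
Local Open Scope ring_scope.

Definition borel_matrix_display : measure_display.
Proof. exact: default_measure_display. Qed.

Section borel_matrix.
Context (R : realType) (m n : nat).

Let borel := <<s @open 'M[R]_(m, n) >>.

Let borel0 : borel set0. Proof. exact: sigma_algebra0. Qed.

Let borelC A : borel A -> borel (~` A). Proof. exact: sigma_algebraC. Qed.

Let borel_bigcup (F : (set 'M[R]_(m, n))^nat) :
  (forall i, borel (F i)) -> borel (\bigcup_i F i).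
Proof. exact: sigma_algebra_bigcup. Qed.

(* From here on, [measurable] means Borel on matrices, hence on 'rV[R]_d. *)
HB.instance Definition _ := @isMeasurable.Build borel_matrix_display
  'M[R]_(m, n) borel borel0 borelC borel_bigcup.

End borel_matrix.

Lemma measurable_fun_mx_coord (R : realType) m n i j :
  measurable_fun setT (fun M : 'M[R]_(m, n) => M i j : measurableTypeR R).
Proof.
apply: (measurability _ (RGenOpens.measurableE R)) => _ [_ [a [b ->] <-]].
rewrite setTI; apply: sub_sigma_algebra.
have /continuousP := @coord_continuous R m n i j.
by apply; exact: interval_open.
Qed.

Lemma measurable_fun_mx (R : realType) d (T : measurableType d) m n
    (f : T -> 'M[R]_(m, n)) :
  (forall i j, measurable_fun setT (fun x => f x i j : measurableTypeR R)) ->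
  measurable_fun setT f.
Proof.
move=> mf; apply: (@measurability _ _ _ _ _ _ (@open 'M[R]_(m, n))) => //.
move=> _ [U oU <-]; rewrite setTI.
pose c (p : 'M[rat]_(m, n) * nat) : set 'M[R]_(m, n) :=
  ball (map_mx (@ratr R) p.1) p.2.+1%:R^-1.
have -> : f @^-1` U = \bigcup_p
    (if pselect (c p `<=` U) then f @^-1` (c p) else set0).
  apply/seteqP; split => [x Ux|x [p _]]; last by case: pselect => // cU; exact: cU.
  have : nbhs (f x) U by exact: open_nbhs_nbhs.
  move=> /nbhs_ballP[e /= e0 xeU].
  have [k ke] : exists k : nat, (k.+1%:R^-1 : R) < e / 2.
    have /ltr_add_invr[k] : 0 < e / 2 by rewrite divr_gt0.
    by rewrite add0r => ?; exists k.
  have k0 : 0 < (k.+1%:R^-1 : R) by rewrite invr_gt0.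
  have /choice[q qP] : forall ij : 'I_m * 'I_n, exists q : rat,
      ball (f x ij.1 ij.2) k.+1%:R^-1 (ratr q : R).
    move=> ij.
    have /rat_in_itvoo[q] : f x ij.1 ij.2 < f x ij.1 ij.2 + k.+1%:R^-1.
      by rewrite ltrDl.
    rewrite in_itv/= => /andP[q1 q2]; exists q.
    rewrite /ball/= ltr_norml; move: k0 q1 q2; move: (k.+1%:R^-1) => h.
    by move=> *; apply/andP; split; lra.
  exists (\matrix_(i, j) q (i, j), k) => //.
  have qx : ball (map_mx (@ratr R) (\matrix_(i, j) q (i, j))) k.+1%:R^-1 (f x).
    by split=> // i j; rewrite !mxE; apply: ball_sym; exact: (qP (i, j)).
  case: pselect => // -[] y /= qy; apply: xeU.
  apply: (@le_ball _ _ _ (k.+1%:R^-1 + k.+1%:R^-1)).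
    by rewrite [leRHS](splitr e) ltW// ltrD.
  by apply: ball_triangle qy; exact: ball_sym.
apply: countable_bigcupT_measurable => // p.
case: pselect => [cU|ncU]; last exact: measurable0.
have -> : f @^-1` c p = \bigcap_(ij : 'I_m * 'I_n)
    ((fun x => f x ij.1 ij.2) @^-1` ball (ratr (p.1 ij.1 ij.2) : R) p.2.+1%:R^-1).
  apply/seteqP; split => [x [_ cx] [i j] _ /=|x cx].
    by have := cx i j; rewrite mxE.
  by split=> [|i j]; [rewrite invr_gt0|rewrite mxE; exact: (cx (i, j))].
apply: fin_bigcap_measurable => // -[i j] _ /=.
rewrite -[X in measurable X]setTI; apply: mf => //.
by apply: open_measurable; exact: ball_open.
Qed.

Section lebesgue_step.
Context (R : realType) (n : nat).

Definition rV_cons (x : R * 'rV[R]_n) : 'rV[R]_n.+1 :=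
  row_mx (x.1)%:M x.2 : 'rV[R]_(1 + n).

Definition rV_uncons (u : 'rV[R]_n.+1) : measurableTypeR R * 'rV[R]_n :=
  (u 0 0, rsubmx (u : 'rV[R]_(1 + n))).

Lemma rV_consK : cancel rV_cons rV_uncons.
Proof.
case=> x v; rewrite /rV_uncons /rV_cons row_mxKr; congr pair.
rewrite /= (_ : 0 = lshift n (0 : 'I_1)); last exact: val_inj.
by rewrite (row_mxEl (x%:M : 'rV_1) v) mxE eqxx mulr1n.
Qed.

Lemma measurable_rV_cons :
  measurable_fun setT (rV_cons : measurableTypeR R * 'rV[R]_n -> _).
Proof.
apply: measurable_fun_mx => i j.
case: (@splitP 1 n j) => k jk.
  rewrite (_ : (fun _ => _) = fst)//; apply/funext => -[x v].
  rewrite (_ : j = lshift n k); last exact: val_inj.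
  by rewrite /rV_cons (row_mxEl (x%:M : 'rV_1) v) !ord1 mxE eqxx mulr1n.
rewrite (_ : (fun _ => _) = (fun v : 'rV[R]_n => v i k) \o snd).
  apply: measurableT_comp; last exact: measurable_snd.
  exact: measurable_fun_mx_coord.
apply/funext => -[x v] /=.
rewrite (_ : j = rshift 1 k); last exact: val_inj.
by rewrite /rV_cons (row_mxEr (x%:M : 'rV_1) v).
Qed.

Lemma measurable_rV_uncons : measurable_fun setT rV_uncons.
Proof.
apply: measurable_fun_pair; first exact: measurable_fun_mx_coord.
apply: measurable_fun_mx => i j.
rewrite (_ : (fun _ => _) = (fun u : 'rV[R]_n.+1 => u i (rshift 1 j))).
  exact: measurable_fun_mx_coord.
by apply/funext => u; rewrite mxE.
Qed.

Variable mu : {sigma_finite_measure set 'rV[R]_n -> \bar R}.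

Definition lebesgue_step : set 'rV[R]_n.+1 -> \bar R :=
  pushforward ((@lebesgue_measure R) \x mu)%E rV_cons.

Let prod_mu : {measure set (measurableTypeR R * 'rV[R]_n)%type -> \bar R} :=
  ((@lebesgue_measure R) \x mu)%E.

Let lebesgue_step0 : lebesgue_step set0 = 0%E.
Proof. by rewrite /lebesgue_step /pushforward preimage_set0 measure0. Qed.

Let lebesgue_step_ge0 A : (0 <= lebesgue_step A)%E.
Proof. exact: (measure_ge0 prod_mu). Qed.

Let lebesgue_step_sigma_additive : semi_sigma_additive lebesgue_step.
Proof.
move=> F mF tF mUF; rewrite /lebesgue_step /pushforward preimage_bigcup.
have mcons (B : set 'rV[R]_n.+1) : measurable B -> measurable (rV_cons @^-1` B).
  by move=> mB; rewrite -[X in measurable X]setTI; exact: measurable_rV_cons.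
apply: (@measure_semi_sigma_additive _ _ _ prod_mu).
- by move=> k; exact: mcons.
- apply/trivIsetP => i j _ _ ij; rewrite -preimage_setI.
  by move/trivIsetP : tF => /(_ _ _ I I ij) ->; rewrite preimage_set0.
- by rewrite -preimage_bigcup; exact: mcons.
Qed.

HB.instance Definition _ := isMeasure.Build _ _ _ lebesgue_step
  lebesgue_step0 lebesgue_step_ge0 lebesgue_step_sigma_additive.

Let lebesgue_step_sigma_finite : sigma_finite setT lebesgue_step.
Proof.
have /sigma_finiteP[F [FT ndF Foo]] := sigma_finiteT (@lebesgue_measure R).
have /sigma_finiteP[G [GT ndG Goo]] := sigma_finiteT mu.
exists (fun k => rV_uncons @^-1` (F k `*` G k)).
  rewrite -preimage_bigcup -[LHS](preimage_setT rV_uncons); congr (_ @^-1` _).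
  apply/esym; rewrite -subTset => -[x v] _.
  have [i _ Fx] : (\bigcup_i F i) x by rewrite -FT.
  have [j _ Gv] : (\bigcup_i G i) v by rewrite -GT.
  exists (maxn i j) => //; split.
  - by move: Fx; exact/subsetPset/ndF/leq_maxl.
  - by move: Gv; exact/subsetPset/ndG/leq_maxr.
move=> k; have [mF Fk] := Foo k; have [mG Gk] := Goo k; split.
  rewrite -[X in measurable X]setTI; apply: measurable_rV_uncons => //.
  exact: measurableX.
rewrite /lebesgue_step /pushforward -comp_preimage (_ : _ \o _ = id).
  by rewrite preimage_id product_measure1E// lte_mul_pinfty// ge0_fin_numE.
by apply/funext => x; exact: rV_consK.
Qed.

HB.instance Definition _ := Measure_isSigmaFinite.Build _ _ _ lebesgue_step
  lebesgue_step_sigma_finite.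

End lebesgue_step.

Fixpoint lebesgue_rV (R : realType) (d : nat) :
    {sigma_finite_measure set 'rV[R]_d -> \bar R} :=
  if d is n.+1 then lebesgue_step (lebesgue_rV R n) else \d_(0 : 'rV[R]_0).

Section surface_measure.
Context (R : realType) (d : nat).
Implicit Types (A : set 'rV[R]_d) (mu : set 'rV[R]_d -> \bar R).

(* The norm `|x| of the library on 'rV[R]_d is the sup norm. *)
Definition enorm (x : 'rV[R]_d) : R := Num.sqrt (\sum_(i < d) x 0 i ^+ 2).

Definition eball (r : R) : set 'rV[R]_d := [set x | enorm x <= r].

Definition neighborhood (e : R) A : set 'rV[R]_d :=
  [set x | exists2 a, A a & enorm (x - a) < e].

(* Meaningful for mu A < +oo only: in \bar R, +oo - +oo is -oo. *)
Definition surface_measure mu A : \bar R :=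
  limf_einf (fun e : R => (mu (neighborhood e A) - mu A) * e^-1%:E)%E 0^'+.

Definition radial_measure (v : R -> R) : set 'rV[R]_d -> \bar R :=
  fun A => (\int[lebesgue_rV R d]_(x in A) (expR (v (enorm x)))%:E)%E.

End surface_measure.

Arguments eball {R} d r _.
Arguments radial_measure {R} d v _.

(* Main.v *)
Require Import Defs.
From HB Require Import structures.
From mathcomp Require Import all_boot all_order all_algebra.
From mathcomp Require Import all_classical all_reals all_analysis.
From mathcomp Require Import measurable_realfun ring lra.
Import Order.TTheory GRing.Theory Num.Theory.
Import numFieldNormedType.Exports.
Local Open Scope classical_set_scope.
Local Open Scope ring_scope.

Set Implicit Arguments.
Unset Strict Implicit.
Unset Printing Implicit Defensive.

(** The inequality holds with the better constant 1/3, and it comes from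
    comparing enlargements at one small scale. Write w = e^v, B for the ball of
    radius r, m for the common mass of A and B, and D_p for the integral over B
    of w(|x| + p). For p = theta * delta with theta < 1,

    (i)   mu(A^delta) >= D_p,
    (ii)  mu(A^delta) >= (1 + p / (2 r))^d m,
    (iii) mu(B^p) <= q D_p, where q = (1 + p / r)^d.

    By (iii), mu(B^p) - m <= q (D_p - m) + (q - 1) m. By (i), the first term is
    at most q (mu(A^delta) - m). Since q - 1 <= d (p / r) q, and since (ii)
    yields d (p / r) m <= 2 (mu(A^delta) - m), the second term is at most
    2 q (mu(A^delta) - m). Altogether
    mu(B^p) - m <= 3 q (mu(A^delta) - m) ([radial_increment_le]). When delta
    tends to 0, q tends to 1; as 3 < sqrt (1 + pi^2), because pi^2 > 8, the
    factors q and 1 / theta are absorbed, and the lower limits compare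
    ([limf_einf_at_right_rescale]).

    Estimate (iii) is a dilation. For (i), every point of A is moved away from
    the origin by p. This stays in A^delta and does not decrease volume, being
    a translation of the radius s against the nondecreasing polar density
    s^(d-1) ([radial_push]). So mu(A^delta) is at least the integral over A of
    w(|x| + p). Convexity of v makes w(s + p) / w(s) nondecreasing, and the
    bathtub principle replaces A by B ([shifted_mass_ge_ball]).

    For (ii), half of delta is spent on an enlargement and half on a radial
    displacement, which makes up for the decrease of |x| that the enlargement
    may cause. As w is nondecreasing, A has at most the volume of B
    ([volume_le_ball]), and so have its parts where w > t. The Euclidean
    isoperimetric inequality ([lebesgue_neighborhood_ge]) lets each of these
    grow by the factor (1 + p / (2 r))^d, and integrating over t gives (ii)
    ([radial_neighborhood_ge]). The isoperimetric inequality is deduced from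
    the Brunn-Minkowski inequality, which is proved by induction on the
    dimension from the Prekopa-Leindler inequality on the line. *)

(** * Affine substitutions and the layer cake formula *)

Section line.
Context (R : realType).
Local Notation leb := (@lebesgue_measure R).
Local Open Scope ereal_scope.

Let affine_measurable (c b : R) :
  measurable_fun setT ((fun x => c * x + b)%R : measurableTypeR R -> measurableTypeR R).
Proof. by apply: measurable_funD => //; exact: measurable_funM. Qed.

(** Both sides agree on half-open intervals, and a measure on the line is
    determined by its values there. *)
Lemma lebesgue_affine (c b : R) (A : set (measurableTypeR R)) :
  (0 < c)%R -> measurable A ->
  leb A = c%:E * leb ((fun x => c * x + b)%R @^-1` A).
Proof.
move=> c0 mA; have c0' := ltW c0.
pose phi : measurableTypeR R -> measurableTypeR R := (fun x => c * x + b)%R.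
have mphi : measurable_fun setT phi by exact: affine_measurable.
pose nu0 := measure_function_pushforward__canonical__measure_function_Measure leb mphi.
pose nu : {measure set (measurableTypeR R) -> \bar R} := mscale (NngNum c0') nu0.
rewrite (_ : c%:E * _ = nu A)//.
apply: (@lebesgue_measure_unique R nu) => // _ [[a b']] _ <-.
rewrite lebesgue_measure_itv/= lte_fin.
transitivity (c%:E * leb (phi @^-1` `]a, b']%classic)); last by [].
rewrite (_ : _ @^-1` _ = `]((a - b) / c)%R, ((b' - b) / c)%R]%classic); last first.
  apply/seteqP; split => x; rewrite /phi /= !in_itv/=;
    by rewrite ltr_pdivrMr// ler_pdivlMr// ltrBlDr lerBrDr mulrC.
rewrite lebesgue_measure_itv/= lte_fin ltr_pM2r ?invr_gt0// ltrD2r.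
case: ifPn => // _; last by rewrite mule0.
by rewrite -!EFinD -EFinM; congr EFin; field; rewrite gt_eqF.
Qed.

Lemma ge0_integral_affine (c b : R) (f : R -> \bar R) : (0 < c)%R ->
  measurable_fun [set: measurableTypeR R] f -> (forall x, 0 <= f x) ->
  \int[leb]_x f x = c%:E * \int[leb]_x f (c * x + b)%R.
Proof.
move=> c0 mf f0; have c0' := ltW c0.
pose phi : measurableTypeR R -> measurableTypeR R := (fun x => c * x + b)%R.
have mphi : measurable_fun setT phi by exact: affine_measurable.
pose nu0 := measure_function_pushforward__canonical__measure_function_Measure leb mphi.
transitivity (\int[mscale (NngNum c0') nu0]_x f x).
  by apply: eq_measure_integral => //= A mA _; exact: lebesgue_affine.
by rewrite ge0_integral_mscale// ge0_integral_pushforward.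
Qed.

End line.

Section layer_cake.
Context d (T : measurableType d) (R : realType).
Variables (mu : {sigma_finite_measure set T -> \bar R}) (f : T -> \bar R).
Hypotheses (mf : measurable_fun setT f) (f0 : forall x, (0 <= f x)%E).
Local Notation leb := (@lebesgue_measure R).
Local Open Scope ereal_scope.

Let under : set (T * measurableTypeR R) :=
  [set z | (0 < z.2)%R /\ z.2%:E < f z.1].

Let under_measurable : measurable under.
Proof.
rewrite (_ : under = (snd @^-1` `]0%R, +oo[) `&`
   [set z | (fun z => z.2%:E) z < (f \o fst) z]); last first.
  by apply/seteqP; split => -[x t] /=; rewrite in_itv/= andbT.
apply: measurableI.
  rewrite -[X in measurable X]setTI; apply: measurable_snd => //.
rewrite -[X in measurable X]setTI; apply: emeasurable_fun_lt => //.
  by apply/measurable_EFinP; exact: measurable_snd.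
by apply: measurableT_comp => //; exact: measurable_fst.
Qed.

Let under_ysection t :
  ysection under t = [set x | (0 < t)%R /\ t%:E < f x].
Proof. by apply/seteqP; split => x; rewrite /ysection /= inE. Qed.

Lemma measurable_level t : measurable [set x | (0 < t)%R /\ t%:E < f x].
Proof. by rewrite -under_ysection; exact: measurable_ysection. Qed.
Lemma measurable_fun_level :
  measurable_fun [set: measurableTypeR R]
    (fun t => mu [set x | (0 < t)%R /\ t%:E < f x]).
Proof.
under eq_fun do rewrite -under_ysection.
exact: measurable_fun_ysection.
Qed.

(** The set [under] below the graph of [f] has the product measure computed by
    vertical slices on the left and by horizontal slices on the right. The
    condition [0 < t] sits inside the level set, so that every integral runs
    over the whole line. *)
Lemma layer_cake :
  \int[mu]_x f x = \int[leb]_t mu [set x | (0 < t)%R /\ t%:E < f x].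
Proof.
have f_leb x : f x = leb [set t : measurableTypeR R | (0 < t)%R /\ t%:E < f x].
  have := f0 x; case: (f x) => [y| |] // y0.
    rewrite (_ : mkset _ = `]0%R, y[%classic); last first.
      apply/seteqP; split => t /=; rewrite in_itv/= ?lte_fin.
        by move=> [-> ->].
      by move=> /andP[]; split.
    rewrite lebesgue_measure_itv/= lte_fin; move: y0; rewrite lee_fin.
    by case: ltgtP => // [y0|<-//]; rewrite oppr0 adde0.
  rewrite (_ : mkset _ = `]0%R, +oo[%classic); last first.
    by apply/seteqP; split => t /=; rewrite in_itv/= ltry andbT; [move=> []|split].
  by rewrite lebesgue_measure_itv/= ltry.
transitivity ((mu \x leb) under).
  apply: eq_integral => x _; rewrite f_leb /=; congr (leb _).
  by apply/seteqP; split => t; rewrite /xsection /= inE.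
rewrite (@product_measure_unique _ _ _ _ _ mu leb (mu \x^ leb))//; last first.
  by move=> A B mA mB; exact: product_measure2E.
by apply: eq_integral => t _; rewrite -under_ysection.
Qed.

End layer_cake.

(** * The Prekopa-Leindler inequality on the line *)

Section line_brunn_minkowski.
Context (R : realType).
Local Notation leb := (@lebesgue_measure R).
Local Open Scope ereal_scope.
Implicit Types A B C : set R.

Lemma lebesgue_translate (b : R) A : measurable A ->
  leb ((fun x => x + b)%R @^-1` A) = leb A.
Proof.
move=> mA; rewrite [RHS](@lebesgue_affine R 1 b)// mul1e.
by congr (leb _); apply/seteqP; split => x /=; rewrite mul1r.
Qed.

Let measurable_translate (b : R) A : measurable A ->
  measurable ((fun x => x + b)%R @^-1` A).
Proof.
move=> mA; rewrite -[X in measurable X]setTI.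
suff : measurable_fun setT ((fun x => x + b)%R : measurableTypeR R -> measurableTypeR R).
  by apply.
exact: measurable_funD.
Qed.

(** Up to a loss of [e], one may cut [A] on the right at a point [a1] near its
    supremum and [B] on the left at a point [b1] near its infimum. The
    translates [A1 + b1] and [a1 + B1] then lie on either side of [a1 + b1] and
    both in [C], so their measures add up. *)
Lemma lebesgue_sum_ge A B C :
  measurable A -> measurable B -> measurable C ->
  A !=set0 -> B !=set0 -> has_ubound A -> has_lbound B ->
  (forall a b, A a -> B b -> C (a + b)%R) ->
  leb A + leb B <= leb C.
Proof.
move=> mA mB mC A0 B0 uA lB ABC; apply/lee_addgt0Pr => e e0.
have e2 : (0 < e / 2)%R by rewrite divr_gt0.
have [a1 Aa1 Ha1] : exists2 a, A a & (sup A - e / 2 < a)%R.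
  by apply: sup_adherent.
have [b1 Bb1 Hb1] : exists2 b, B b & (b < inf B + e / 2)%R.
  by apply: inf_adherent.
pose A1 := A `&` `]-oo, a1]; pose B1 := B `&` `]b1, +oo[.
have mA1 : measurable A1 by apply: measurableI.
have mB1 : measurable B1 by apply: measurableI.
have leA : leb A <= leb A1 + (e / 2)%:E.
  have -> : (e / 2)%:E = leb `]a1, (a1 + e / 2)%R].
    rewrite lebesgue_measure_itv/= lte_fin ltrDl e2 -EFinD; congr EFin; ring.
  apply: le_trans (measureU2 _ _ _) => //.
  apply: le_measure; rewrite ?inE//; first exact: measurableU.
  move=> x Ax; have [xa|ax] := leP x a1; [left|right]; rewrite /= ?in_itv//=.
  apply/andP; split => //; apply: (@le_trans _ _ (sup A)).
    exact: ub_le_sup.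
  by rewrite -lerBlDr ltW.
have leB : leb B <= leb B1 + (e / 2)%:E.
  have -> : (e / 2)%:E = leb `[(b1 - e / 2)%R, b1].
    rewrite lebesgue_measure_itv/= lte_fin gtrBl e2 -EFinD; congr EFin; ring.
  apply: le_trans (measureU2 _ _ _) => //.
  apply: le_measure; rewrite ?inE//; first exact: measurableU.
  move=> x Bx; have [xb|bx] := leP x b1; [right|left]; rewrite /= ?in_itv//=.
    apply/andP; split => //; apply: (@le_trans _ _ (inf B)).
      by rewrite lerBlDr ltW.
    exact: ge_inf.
  by split => //=; rewrite in_itv/= bx.
have le1 : leb A1 + leb B1 <= leb C.
  rewrite -(lebesgue_translate (- b1) mA1) -(lebesgue_translate (- a1) mB1).
  rewrite -measureU//; [|exact: measurable_translate..|].
    apply: le_measure; rewrite ?inE//.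
      by apply: measurableU; exact: measurable_translate.
    move=> x [[Ax _]|[Bx _]].
      by rewrite -(subrK b1 x); exact: ABC.
    by rewrite -(subrKC a1 x); exact: ABC.
  apply/seteqP; split => // x [[_ xa] [_ bx]].
  have {}xa : (x - b1 <= a1)%R by move: xa; rewrite /= in_itv.
  have {}bx : (b1 < x - a1)%R by move: bx; rewrite /= in_itv/= andbT.
  by move: bx; rewrite ltrBrDr -ltrBrDl ltNge xa.
apply: (le_trans (leeD leA leB)).
by rewrite addeACA -EFinD -splitr leeD2r.
Qed.

Lemma lebesgue_convex_combination_ge (l : R) A B C : (0 < l < 1)%R ->
  measurable A -> measurable B -> measurable C ->
  A !=set0 -> B !=set0 -> has_ubound A -> has_lbound B ->
  (forall a b, A a -> B b -> C ((1 - l) * a + l * b)%R) ->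
  (1 - l)%:E * leb A + l%:E * leb B <= leb C.
Proof.
move=> /andP[l0 l1] mA mB mC [a0 Aa0] [b0 Bb0] [ua uA] [lb lB] ABC.
have l1' : (0 < 1 - l)%R by rewrite subr_gt0.
have scaled (c : R) (X : set R) : (0 < c)%R -> measurable X ->
    measurable ((fun x => c^-1 * x + 0)%R @^-1` X) /\
    c%:E * leb X = leb ((fun x => c^-1 * x + 0)%R @^-1` X).
  move=> c0 mX; split; last first.
    rewrite (@lebesgue_affine R c^-1 0 X) ?invr_gt0// muleA -EFinM.
    by rewrite divff ?gt_eqF// mul1e.
  rewrite -[X in measurable X]setTI.
  suff : measurable_fun setT
      ((fun x => c^-1 * x + 0)%R : measurableTypeR R -> measurableTypeR R).
    by apply.
  by apply: measurable_funD => //; exact: measurable_funM.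
have [mA' ->] := scaled _ _ l1' mA; have [mB' ->] := scaled _ _ l0 mB.
apply: lebesgue_sum_ge => //.
- by exists ((1 - l) * a0)%R; rewrite /= addr0 mulKf ?gt_eqF.
- by exists (l * b0)%R; rewrite /= addr0 mulKf ?gt_eqF.
- exists ((1 - l) * ua)%R => x /= /uA; rewrite addr0 mulrC ler_pdivrMr//.
  by rewrite mulrC.
- exists (l * lb)%R => x /= /lB; rewrite addr0 [(l^-1 * _)%R]mulrC ler_pdivlMr//.
  by rewrite mulrC.
- move=> a b /= Aa Bb; have := ABC _ _ Aa Bb; rewrite !addr0.
  by rewrite !mulVKf ?gt_eqF.
Qed.

(** The Prekopa-Leindler inequality for functions with supremum 1. This
    normalisation makes both level sets at each height [t < 1] nonempty, so the
    one-dimensional Brunn-Minkowski inequality applies at every height; the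
    layer cake formula integrates the result. The conclusion is the arithmetic
    mean, which is stronger than the geometric one. *)
Lemma prekopa_leindler_line (l M : R) (f g h : measurableTypeR R -> \bar R) :
  (0 < l < 1)%R ->
  measurable_fun setT f -> measurable_fun setT g -> measurable_fun setT h ->
  (forall x, 0 <= f x <= 1) -> (forall x, 0 <= g x <= 1) ->
  (forall x, 0 <= h x) ->
  (forall u : R, (u < 1)%R -> exists x, u%:E < f x) ->
  (forall u : R, (u < 1)%R -> exists x, u%:E < g x) ->
  (forall x, 0 < f x -> (`|x| <= M)%R) -> (forall x, 0 < g x -> (`|x| <= M)%R) ->
  (forall (u : R) x y, (0 < u)%R -> u%:E < f x -> u%:E < g y ->
     u%:E < h ((1 - l) * x + l * y)%R) ->
  (1 - l)%:E * \int[leb]_x f x + l%:E * \int[leb]_x g x <= \int[leb]_x h x.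
Proof.
move=> /andP[l0 l1] mf mg mh f01 g01 h0 fsup gsup fM gM fgh.
have f0 x : 0 <= f x by case/andP: (f01 x).
have g0 x : 0 <= g x by case/andP: (g01 x).
have l1' : (0 <= 1 - l)%R by rewrite subr_ge0 ltW.
have mi k (mk : measurable_fun setT k) (k0 : forall x, 0 <= k x) :=
  measurable_fun_level leb mk.
rewrite (layer_cake leb mf f0) (layer_cake leb mg g0) (layer_cake leb mh h0).
rewrite -(ge0_integralZl_EFin leb measurableT _ (mi f mf f0) l1')//.
rewrite -(ge0_integralZl_EFin leb measurableT _ (mi g mg g0) (ltW l0))//.
rewrite -ge0_integralD//; last 4 first.
- by move=> t _; rewrite mule_ge0// lee_fin.
- by apply: measurable_funeM; exact: mi.
- by move=> t _; rewrite mule_ge0// lee_fin ltW.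
- by apply: measurable_funeM; exact: mi.
apply: ge0_le_integral => //.
- by move=> t _; rewrite adde_ge0// mule_ge0// lee_fin// ltW.
- by apply: emeasurable_funD; apply: measurable_funeM; exact: mi.
- exact: mi.
move=> t _.
(* Outside ]0, 1[ the level sets of f and g are empty. *)
have empty k : (t <= 0)%R \/ (1 <= t)%R -> (forall x, k x <= 1) ->
    leb [set x : measurableTypeR R | (0 < t)%R /\ t%:E < k x] = 0.
  move=> Ht k1; rewrite (_ : mkset _ = set0) ?measure0//.
  apply/seteqP; split => // x /= [t0 tk].
  case: Ht; [by rewrite leNgt t0|move=> t1].
  have := lt_le_trans tk (k1 x); rewrite lte_fin ltNge t1//.
have fle1 x : f x <= 1 by case/andP: (f01 x).
have gle1 x : g x <= 1 by case/andP: (g01 x).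
have [t0|t0] : (t <= 0 \/ 0 < t)%R by case: (leP t 0%R); [left|right].
  rewrite [X in _ * X + _](empty f) ?[X in _ + _ * X](empty g)//; try by left.
  by rewrite !mule0 adde0.
have [t1|t1] : (1 <= t \/ t < 1)%R by case: (leP 1%R t); [left|right].
  rewrite [X in _ * X + _](empty f) ?[X in _ + _ * X](empty g)//; try by right.
  by rewrite !mule0 adde0.
have [x0 fx0] := fsup _ t1; have [y0 gy0] := gsup _ t1.
apply: lebesgue_convex_combination_ge; rewrite ?l0 ?l1//; try exact: measurable_level.
- by exists x0.
- by exists y0.
- exists M => x /= [_ tf]; apply: le_trans (ler_norm _) (fM _ _).
  by apply: lt_trans tf; rewrite lte_fin.
- exists (- M)%R => x /= [_ tg]; rewrite lerNl.
  apply: le_trans (ler_norm _) _; rewrite normrN; apply: gM.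
  by apply: lt_trans tg; rewrite lte_fin.
- by move=> a b /= [_ tf] [_ tg]; split => //; exact: fgh.
Qed.

End line_brunn_minkowski.

(** * Slices, dilations and boxes *)

Section slices.
Context (R : realType).
Local Notation leb := (@lebesgue_measure R).
Local Open Scope ereal_scope.

Lemma rV_cons_scale n (c t : R) (w : 'rV[R]_n) :
  c *: rV_cons (t, w) = rV_cons ((c * t)%R, c *: w).
Proof. by rewrite /rV_cons (scale_row_mx c (t%:M : 'rV_1) w) scale_scalar_mx. Qed.

Lemma rV_cons_add n (s t : R) (u w : 'rV[R]_n) :
  (rV_cons (s, u) + rV_cons (t, w) = rV_cons ((s + t)%R, u + w))%R.
Proof. by rewrite /rV_cons (add_row_mx (s%:M : 'rV_1) u) -raddfD. Qed.

Lemma rV_cons0 n (x : R * 'rV[R]_n) : rV_cons x 0%R 0%R = x.1.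
Proof. exact: (congr1 fst (rV_consK x)). Qed.

Lemma rV_consS n (x : R * 'rV[R]_n) i : rV_cons x 0%R (lift 0%R i) = x.2 0%R i.
Proof.
rewrite (_ : lift 0%R i = rshift 1 i); last exact: val_inj.
by rewrite /rV_cons (row_mxEr (x.1%:M : 'rV_1) x.2).
Qed.

Definition slice n (E : set 'rV[R]_n.+1) (t : R) : set 'rV[R]_n :=
  [set w | E (rV_cons (t, w))].

Let measurable_uncons_preimage n (E : set 'rV[R]_n.+1) : measurable E ->
  measurable ((@rV_cons R n : measurableTypeR R * 'rV[R]_n -> _) @^-1` E).
Proof.
by move=> mE; rewrite -[X in measurable X]setTI; exact: measurable_rV_cons.
Qed.

Let slice_xsection n (E : set 'rV[R]_n.+1) t :
  slice E t = xsection ((@rV_cons R n) @^-1` E) t.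
Proof. by apply/seteqP; split => w; rewrite /xsection /slice /= inE. Qed.

Lemma measurable_slice n (E : set 'rV[R]_n.+1) t :
  measurable E -> measurable (slice E t).
Proof.
move=> mE; rewrite slice_xsection.
exact: (measurable_xsection t (measurable_uncons_preimage mE)).
Qed.

Lemma measurable_fun_slice n (E : set 'rV[R]_n.+1) : measurable E ->
  measurable_fun [set: measurableTypeR R] (fun t => lebesgue_rV R n (slice E t)).
Proof.
move=> mE; under eq_fun do rewrite slice_xsection.
exact: measurable_fun_xsection (measurable_uncons_preimage mE).
Qed.

Lemma lebesgue_rV_slice n (E : set 'rV[R]_n.+1) : measurable E ->
  lebesgue_rV R n.+1 E = \int[leb]_t lebesgue_rV R n (slice E t).
Proof.
by move=> mE; apply: eq_integral => t _; rewrite slice_xsection.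
Qed.

Lemma measurable_fun_coord n (i : 'I_n) :
  measurable_fun setT (fun x : 'rV[R]_n => x 0%R i : measurableTypeR R).
Proof. exact: measurable_fun_mx_coord. Qed.

Lemma measurable_fun_scale n (c : R) :
  measurable_fun setT (fun x : 'rV[R]_n => c *: x).
Proof.
apply: measurable_fun_mx => i j; under eq_fun do rewrite mxE.
by apply: measurable_funM => //; exact: measurable_fun_mx_coord.
Qed.

Lemma measurable_scale_preimage n (c : R) (E : set 'rV[R]_n) :
  measurable E -> measurable [set x | E (c *: x)].
Proof.
by move=> mE; rewrite -[X in measurable X]setTI; exact: measurable_fun_scale.
Qed.

(** Induction on the dimension: the slice at height [t] of the preimage of [E]
    under a dilation is the preimage of the slice at height [c * t]. *)
Lemma lebesgue_rV_scale n (c : R) (E : set 'rV[R]_n) : (0 < c)%R ->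
  measurable E ->
  lebesgue_rV R n E = (c ^+ n)%:E * lebesgue_rV R n [set x | E (c *: x)].
Proof.
move=> c0; elim: n E => [|n IH] E mE.
  rewrite expr0 mul1e; congr (lebesgue_rV R 0 _).
  apply/seteqP; split => x /=; by rewrite (thinmx0 (c *: x)) (thinmx0 x).
have mcE := measurable_scale_preimage c mE.
rewrite !lebesgue_rV_slice//.
rewrite (@ge0_integral_affine R c 0)//; last exact: measurable_fun_slice.
rewrite exprS EFinM -muleA; congr (_ * _).
rewrite -ge0_integralZl//; last 2 first.
- exact: measurable_fun_slice.
- by rewrite lee_fin exprn_ge0// ltW.
apply: eq_integral => t _; rewrite addr0 IH; last exact: measurable_slice.
congr (_ * lebesgue_rV R n _); apply/seteqP; split => w;
  by rewrite /slice /= rV_cons_scale.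
Qed.

Lemma ge0_integral_scale n (c : R) (f : 'rV[R]_n -> \bar R) : (0 < c)%R ->
  measurable_fun setT f -> (forall x, 0 <= f x) ->
  \int[lebesgue_rV R n]_x f x =
  (c ^+ n)%:E * \int[lebesgue_rV R n]_x f (c *: x).
Proof.
move=> c0 mf f0; have cn0 : (0 <= c ^+ n)%R by rewrite exprn_ge0// ltW.
pose nu0 := measure_function_pushforward__canonical__measure_function_Measure
  (lebesgue_rV R n) (@measurable_fun_scale n c).
transitivity (\int[mscale (NngNum cn0) nu0]_x f x).
  by apply: eq_measure_integral => //= A mA _; exact: lebesgue_rV_scale.
rewrite ge0_integral_mscale//; congr (_ * _).
by rewrite ge0_integral_pushforward//; exact: measurable_fun_scale.
Qed.

(** Coordinatewise boundedness is inherited by slices, which makes boxes a more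
    convenient gauge of boundedness than balls in inductions on the
    dimension. *)
Definition box n (M : R) : set 'rV[R]_n := [set x | forall i, (`|x 0%R i| <= M)%R].
Arguments box n M _ : clear implicits.

Lemma measurable_box n M : measurable (box n M).
Proof.
rewrite (_ : box n M = \bigcap_(i : 'I_n) ((fun x : 'rV[R]_n => x 0%R i) @^-1` `[(- M)%R, M])).
  apply: fin_bigcap_measurable => // i _.
  rewrite -[X in measurable X]setTI.
  by apply: measurable_fun_coord => //.
apply/seteqP; split => x /= H i.
  by move=> _; rewrite /= in_itv/= -ler_norml; exact: H.
by rewrite ler_norml; have := H i I; rewrite /= in_itv.
Qed.

Lemma slice_box n M t : slice (box n.+1 M) t `<=` box n M.
Proof. by move=> w H i; have := H (lift 0%R i); rewrite rV_consS. Qed.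

Lemma lebesgue_rV_box n M : lebesgue_rV R n (box n M) < +oo.
Proof.
elim: n => [|n IH].
  rewrite /= /dirac indicE; by case: (_ \in _); rewrite ltry.
rewrite lebesgue_rV_slice; last exact: measurable_box.
apply: (@le_lt_trans _ _ (\int[leb]_t ((fine (lebesgue_rV R n (box n M)))%:E *
    (\1_(`[(- M)%R, M]%classic : set R) t)%:E))).
  apply: ge0_le_integral => //.
  - exact: measurable_fun_slice (@measurable_box _ _).
  - apply: measurable_funeM; apply/measurable_EFinP.
    exact: measurable_indic.
  - move=> t _; rewrite indicE.
    have [|tM] := boolP (t \in _).
      rewrite inE /= => tM; rewrite mule1 fineK; last by rewrite ge0_fin_numE.
      apply: le_measure; rewrite ?inE; [|exact: measurable_box|exact: slice_box].
      exact: measurable_slice (@measurable_box _ _).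
    rewrite mule0 (_ : slice _ _ = set0) ?measure0//.
    apply/seteqP; split => // w /(_ 0%R); rewrite rV_cons0 /= => tM'.
    by move: tM; rewrite notin_setE /= in_itv/= -ler_norml tM'.
rewrite ge0_integralZl_EFin//; [|exact/measurable_EFinP/measurable_indic|exact: fine_ge0].
rewrite integral_indic// setIT [X in _ * X]lebesgue_measure_itv/= -EFinD.
by case: ifP => _; rewrite -?EFinM ?mule0 ltry.
Qed.

End slices.
Arguments box {R} n M _.

(** * The Brunn-Minkowski inequality *)

Section brunn_minkowski.
Context (R : realType).
Local Notation leb := (@lebesgue_measure R).

Lemma powR_AMGM (l a b : R) : 0 < l < 1 -> 0 <= a -> 0 <= b ->
  a `^ (1 - l) * b `^ l <= (1 - l) * a + l * b.
Proof.
move=> /andP[l0 l1] a0 b0; have l1' : 0 < 1 - l by rewrite subr_gt0.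
have := @conjugate_powR R (a `^ (1 - l)) (b `^ l) (1 - l)^-1 l^-1.
rewrite -!powRrM !divff ?gt_eqF// !powRr1// !invrK.
move=> H; rewrite [(1 - l) * a]mulrC [l * b]mulrC.
apply: H; rewrite ?powR_ge0 ?invr_gt0//; ring.
Qed.

Local Open Scope ereal_scope.

Let fslice n (E : set 'rV[R]_n.+1) t := fine (lebesgue_rV R n (slice E t)).

Lemma slice_lt_pinfty n M (E : set 'rV[R]_n.+1) t :
  measurable E -> E `<=` box n.+1 M -> lebesgue_rV R n (slice E t) < +oo.
Proof.
move=> mE EM; apply: le_lt_trans (@lebesgue_rV_box R n M).
apply: le_measure; rewrite ?inE; [exact: measurable_slice|exact: measurable_box|].
by move=> w ?; apply: (@slice_box R n M t); exact: EM.
Qed.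

(** The Brunn-Minkowski inequality in multiplicative form, by induction on the
    dimension. For slices of [A] and [B] at heights [s] and [t], the induction
    hypothesis bounds from below the slice of [C] at height
    [(1 - l) * s + l * t]. Divided by their suprema [F] and [G], the slice
    volumes of [A] and [B] therefore satisfy the hypotheses of the
    one-dimensional Prekopa-Leindler inequality. *)
Lemma brunn_minkowski n (l M : R) (A B C : set 'rV[R]_n) :
  (0 < l < 1)%R -> measurable A -> measurable B -> measurable C ->
  A `<=` box n M -> B `<=` box n M ->
  (forall a b, A a -> B b -> C ((1 - l) *: a + l *: b)%R) ->
  ((fine (lebesgue_rV R n A)) `^ (1 - l) * (fine (lebesgue_rV R n B)) `^ l)%:E
    <= lebesgue_rV R n C.
Proof.
move=> l01; have /andP[l0 l1] := l01; have l1' : (0 < 1 - l)%R by rewrite subr_gt0.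
elim: n A B C => [|n IH] A B C mA mB mC AM BM ABC.
  rewrite /= /dirac !indicE.
  have [A0|nA0] := boolP (0%R \in A); last by rewrite /= powR0 ?gt_eqF// mul0r lee_fin ler0n.
  have [B0|nB0] := boolP (0%R \in B); last by rewrite /= powR0 ?gt_eqF// mulr0 lee_fin ler0n.
  rewrite /= !powR1 mulr1 lee_fin ler1n lt0b inE.
  have := ABC 0%R 0%R; rewrite !scaler0 addr0; apply; exact/set_mem.
(* Either all slices are null, or their volumes have a positive supremum. *)
have slice_profile (X : set 'rV[R]_n.+1) : measurable X -> X `<=` box n.+1 M ->
    fine (lebesgue_rV R n.+1 X) = 0%R \/
    exists2 F : R, (0 < F)%R &
      [/\ forall t, (fslice X t <= F)%R,
          (forall u : R, (u < 1)%R -> exists t, (u < fslice X t / F)%R) &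
          lebesgue_rV R n.+1 X = F%:E * \int[leb]_t (fslice X t / F)%:E].
  move=> mX XM.
  have X_ge0 t : (0 <= fslice X t)%R by exact: fine_ge0.
  have XE t : lebesgue_rV R n (slice X t) = (fslice X t)%:E.
    by rewrite fineK// ge0_fin_numE//; exact: slice_lt_pinfty XM.
  have ubX : has_ubound (range (fslice X)).
    exists (fine (lebesgue_rV R n (box n M))) => _ [t _ <-].
    rewrite -lee_fin -XE fineK; last by rewrite ge0_fin_numE// lebesgue_rV_box.
    apply: le_measure; rewrite ?inE; [exact: measurable_slice|exact: measurable_box|].
    by move=> w ?; apply: (@slice_box R n M t); exact: XM.
  have leF t : (fslice X t <= sup (range (fslice X)))%R by apply: ub_le_sup.
  have [F0|F0] := leP (sup (range (fslice X))) 0%R.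
    left; rewrite lebesgue_rV_slice// (eq_integral (cst 0)) ?integral0//.
    move=> t _; rewrite XE/=; congr EFin; apply/eqP.
    by rewrite eq_le X_ge0 (le_trans (leF t)).
  right; exists (sup (range (fslice X))) => //; split => // [u u1|].
    have [] := @sup_adherent _ (range (fslice X)) (sup (range (fslice X)) * (1 - u)).
    - by rewrite mulr_gt0// subr_gt0.
    - by split => //; exists (fslice X 0), 0%R.
    move=> _ [t _ <-] Ht; exists t; rewrite ltr_pdivlMr//; move: Ht.
    by rewrite mulrBr mulr1 opprB addrC subrK mulrC.
  rewrite -ge0_integralZl_EFin//; last 3 first.
  - by move=> t _; rewrite lee_fin divr_ge0// ltW.
  - apply/measurable_EFinP/measurable_funM => //.
    apply: measurableT_comp => //.
    exact: measurable_fun_slice.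
  - exact: ltW.
  rewrite lebesgue_rV_slice//; apply: eq_integral => t _.
  by rewrite XE -EFinM mulrCA divff ?gt_eqF// mulr1.
have [->|[F F0 [leF supF AE]]] := slice_profile A mA AM.
  by rewrite powR0 ?gt_eqF// mul0r.
have [->|[G G0 [leG supG BE]]] := slice_profile B mB BM.
  by rewrite powR0 ?gt_eqF// mulr0.
pose H : R := (F `^ (1 - l) * G `^ l)%R.
have H0 : (0 < H)%R by rewrite mulr_gt0// powR_gt0.
have fin X : measurable X -> X `<=` box n.+1 M -> lebesgue_rV R n.+1 X < +oo.
  move=> mX XM; apply: le_lt_trans (@lebesgue_rV_box R n.+1 M).
  by apply: le_measure; rewrite ?inE//; exact: measurable_box.
set a := \int[leb]_t (fslice A t / F)%:E in AE.
set b := \int[leb]_t (fslice B t / G)%:E in BE.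
have a0 : 0 <= a.
  by apply: integral_ge0 => t _; rewrite lee_fin divr_ge0 ?(ltW F0) ?fine_ge0.
have b0 : 0 <= b.
  by apply: integral_ge0 => t _; rewrite lee_fin divr_ge0 ?(ltW G0) ?fine_ge0.
have PL : (1 - l)%:E * a + l%:E * b <=
    \int[leb]_t (H^-1%:E * lebesgue_rV R n (slice C t)).
  have mfs (X : set 'rV[R]_n.+1) (K : R) : measurable X ->
      measurable_fun [set: measurableTypeR R] (fun t => (fslice X t / K)%:E).
    move=> mX; apply/measurable_EFinP/measurable_funM => //.
    by apply: measurableT_comp => //; exact: measurable_fun_slice.
  have supp (X : set 'rV[R]_n.+1) (K : R) t : X `<=` box n.+1 M ->
      0 < (fslice X t / K)%:E -> (`|t| <= M)%R.
    move=> XM; rewrite /fslice; have [->|/set0P[w /XM/(_ 0%R)]] := eqVneq (slice X t) set0.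
      by rewrite measure0/= mul0r ltxx.
    by rewrite rV_cons0.
  apply: (@prekopa_leindler_line R l M) => //; try exact: mfs.
  - by apply: measurable_funeM; exact: measurable_fun_slice.
  - move=> t; rewrite !lee_fin divr_ge0 ?(ltW F0)//=; last exact: fine_ge0.
    by rewrite ler_pdivrMr// mul1r.
  - move=> t; rewrite !lee_fin divr_ge0 ?(ltW G0)//=; last exact: fine_ge0.
    by rewrite ler_pdivrMr// mul1r.
  - by move=> t; rewrite mule_ge0// lee_fin invr_ge0 ltW.
  - by move=> t; exact: supp.
  - by move=> t; exact: supp.
  move=> u s t u0; rewrite !lte_fin => us ut.
  apply: (@lt_le_trans _ _ (H^-1%:E *
      (fslice A s `^ (1 - l) * fslice B t `^ l)%:E)).
    rewrite -EFinM lte_fin mulrC ltr_pdivlMr//.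
    have -> : (u * H = (u * F) `^ (1 - l) * (u * G) `^ l)%R.
      rewrite !powRM ?ltW// mulrACA -powRD ?subrK ?powRr1 ?ltW//.
      by rewrite gt_eqF// implybT.
    have uF : (u * F < fslice A s)%R by rewrite -ltr_pdivlMr.
    have uG : (u * G < fslice B t)%R by rewrite -ltr_pdivlMr.
    apply: ltr_pM; rewrite ?powR_ge0//.
      by apply: gt0_ltr_powR => //; rewrite nnegrE ?mulr_ge0 ?(ltW u0) ?(ltW F0) ?fine_ge0.
    by apply: gt0_ltr_powR => //; rewrite nnegrE ?mulr_ge0 ?(ltW u0) ?(ltW G0) ?fine_ge0.
  rewrite lee_pmul2l ?lte_fin ?invr_gt0//.
  apply: IH; try exact: measurable_slice.
  - by move=> w Aw; apply: (@slice_box R n M s) => /=; exact: AM.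
  - by move=> w Bw; apply: (@slice_box R n M t) => /=; exact: BM.
  - move=> x y Ax By; rewrite /slice /= -rV_cons_add -!rV_cons_scale.
    exact: ABC.
rewrite ge0_integralZl_EFin// in PL; last 2 first.
- exact: measurable_fun_slice.
- by rewrite invr_ge0 ltW.
rewrite -lebesgue_rV_slice// in PL.
have finZ (K : R) x : (0 < K)%R -> 0 <= x -> K%:E * x < +oo -> x \is a fin_num.
  move=> K0; case: x => // _; first by rewrite gt0_muley// lte_fin.
have afin : a \is a fin_num by apply: (finZ F) => //; rewrite -AE; exact: fin.
have bfin : b \is a fin_num by apply: (finZ G) => //; rewrite -BE; exact: fin.
rewrite AE BE -(fineK afin) -(fineK bfin) -!EFinM/=.
rewrite -(fineK afin) -(fineK bfin) -!EFinM -EFinD in PL.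
have := powR_AMGM l01 (fine_ge0 a0) (fine_ge0 b0); rewrite -lee_fin => AMGM.
have := le_trans AMGM PL.
rewrite muleC lee_pdivlMr// -EFinM; apply: le_trans.
rewrite lee_fin !powRM ?(fine_ge0 a0) ?(fine_ge0 b0) ?(ltW F0) ?(ltW G0)//.
rewrite /H; move: (F `^ _)%R (G `^ _)%R (fine a `^ _)%R (fine b `^ _)%R => p q x y.
by rewrite mulrACA mulrC.
Qed.

End brunn_minkowski.

(** * The Euclidean norm *)

Section euclidean_norm.
Context (R : realType) (d : nat).
Implicit Types x y z : 'rV[R]_d.

Lemma enorm_ge0 x : 0 <= enorm x.
Proof. exact: sqrtr_ge0. Qed.

Lemma sqr_enorm x : enorm x ^+ 2 = \sum_(i < d) x 0 i ^+ 2.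
Proof. by rewrite sqr_sqrtr// sumr_ge0// => i _; exact: sqr_ge0. Qed.

Lemma enormZ (c : R) x : enorm (c *: x) = `|c| * enorm x.
Proof.
rewrite /enorm -sqrtr_sqr -sqrtrM ?sqr_ge0// mulr_sumr; congr Num.sqrt.
by apply: eq_bigr => i _; rewrite mxE exprMn.
Qed.

Lemma enormN x : enorm (- x) = enorm x.
Proof. by rewrite -scaleN1r enormZ normrN1 mul1r. Qed.

Lemma enorm0 : enorm (0 : 'rV[R]_d) = 0.
Proof. by rewrite -(scale0r 0) enormZ normr0 mul0r. Qed.

Lemma coord_le_enorm x i : `|x 0 i| <= enorm x.
Proof.
rewrite -(ler_pXn2r (ltn0Sn 1)) ?nnegrE ?enorm_ge0// sqr_enorm.
rewrite real_normK ?num_real// (bigD1 i)//= lerDl sumr_ge0// => j _.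
exact: sqr_ge0.
Qed.

(** The discriminant argument: the vector [enorm y ^+ 2 *: x - c *: y] has a
    nonnegative squared norm. *)
Lemma cauchy_schwarz_rV x y : \sum_(i < d) x 0 i * y 0 i <= enorm x * enorm y.
Proof.
set c := \sum_i _; have [b0|b0] := eqVneq (enorm y) 0.
  rewrite b0 mulr0 /c big1// => i _.
  have := coord_le_enorm y i; rewrite b0 normr_le0 => /eqP->.
  by rewrite mulr0.
have {}b0 : 0 < enorm y by rewrite lt_neqAle eq_sym b0 enorm_ge0.
apply: le_trans (ler_norm _) _.
rewrite -(ler_pXn2r (ltn0Sn 1)) ?nnegrE ?mulr_ge0 ?enorm_ge0//.
rewrite real_normK ?num_real// exprMn.
have : 0 <= \sum_(i < d) (enorm y ^+ 2 * x 0 i - c * y 0 i) ^+ 2.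
  by rewrite sumr_ge0// => i _; exact: sqr_ge0.
rewrite (eq_bigr (fun i => enorm y ^+ 4 * x 0 i ^+ 2
    - 2 * enorm y ^+ 2 * c * (x 0 i * y 0 i) + c ^+ 2 * y 0 i ^+ 2)); last first.
  by move=> i _; ring.
rewrite big_split sumrB /= -!mulr_sumr -/c -!sqr_enorm.
rewrite (_ : _ + _ = enorm y ^+ 2 * (enorm x ^+ 2 * enorm y ^+ 2 - c ^+ 2)).
  by rewrite pmulr_rge0 ?exprn_gt0// subr_ge0.
ring.
Qed.

Lemma enorm_triangle x y : enorm (x + y) <= enorm x + enorm y.
Proof.
rewrite -(ler_pXn2r (ltn0Sn 1)) ?nnegrE ?addr_ge0 ?enorm_ge0//.
rewrite sqr_enorm sqrrD !sqr_enorm.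
under eq_bigr do rewrite mxE sqrrD.
rewrite !big_split/= lerD2r lerD2l -mulr2n lerMn2r /=.
exact: cauchy_schwarz_rV.
Qed.

Lemma enorm_le_norm x : enorm x <= d%:R * `|x|.
Proof.
have xd0 : 0 <= d%:R * `|x| by rewrite mulr_ge0.
rewrite -(ler_pXn2r (ltn0Sn 1)) ?nnegrE ?enorm_ge0// sqr_enorm.
apply: (@le_trans _ _ (\sum_(i < d) `|x| ^+ 2)).
  apply: ler_sum => i _; rewrite -real_normK ?num_real//.
  rewrite ler_pXn2r ?nnegrE//.
  rewrite /Num.norm/= mx_normrE.
  by apply/bigmax_geP; right; exists (0, i).
rewrite exprMn sumr_const card_ord -[leLHS]mulr_natl ler_wpM2r ?sqr_ge0//.
by rewrite -natrX ler_nat -mulnn; have [->//|d0] := posnP d; rewrite leq_pmulr.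
Qed.

Lemma measurable_enorm : measurable_fun setT (@enorm R d : _ -> measurableTypeR R).
Proof.
apply: (@measurableT_comp _ _ _ _ _ _ (@Num.sqrt R : measurableTypeR R -> measurableTypeR R)).
  by apply: nondecreasing_measurable => // s t st; exact: ler_wsqrtr.
apply: measurable_sum => i; apply: measurable_funX.
exact: measurable_fun_coord.
Qed.

Lemma measurable_eball r : measurable (@eball R d r).
Proof.
rewrite (_ : eball d r = @enorm R d @^-1` `]-oo, r]).
  by rewrite -[X in measurable X]setTI; exact: measurable_enorm.
by apply/seteqP; split => x; rewrite /= in_itv.
Qed.

Lemma eball_box (r : R) : eball d r `<=` box d r.
Proof. by move=> x xr i; exact: le_trans (coord_le_enorm x i) xr. Qed.

Lemma lebesgue_rV_eball (r : R) : (lebesgue_rV R d (eball d r) < +oo)%E.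
Proof.
apply: le_lt_trans (@lebesgue_rV_box R d r).
by apply: le_measure; rewrite ?inE; [exact: measurable_eball|exact: measurable_box|exact: eball_box].
Qed.

(** The topology of row vectors is that of the sup norm, hence the factor
    [d%:R + 1] in the radius. *)
Lemma open_neighborhood e (A : set 'rV[R]_d) : open (neighborhood e A).
Proof.
rewrite openE => x [a Aa xae] /=.
have d1 : 0 < d%:R + 1 :> R by rewrite ltr_wpDl.
pose eta := (e - enorm (x - a)) / (d%:R + 1).
have eta0 : 0 < eta by rewrite divr_gt0// subr_gt0.
apply/nbhs_ballP; exists eta => //= y; rewrite -ball_normE /= => xy.
exists a => //; rewrite (_ : y - a = (y - x) + (x - a)); last by rewrite addrA subrK.
apply: le_lt_trans (enorm_triangle _ _) _.
rewrite -ltrBrDr; apply: le_lt_trans (enorm_le_norm _) _.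
rewrite -normrN opprB; apply: (@le_lt_trans _ _ ((d%:R + 1) * `|x - y|)).
  by rewrite ler_wpM2r// lerDl.
by rewrite mulrC -ltr_pdivlMr.
Qed.

Lemma measurable_neighborhood e (A : set 'rV[R]_d) :
  measurable (neighborhood e A).
Proof. by apply: sub_sigma_algebra; exact: open_neighborhood. Qed.

End euclidean_norm.

(** * The Euclidean isoperimetric inequality *)

Section euclidean_isoperimetry.
Context (R : realType) (d : nat).
Local Notation mu := (lebesgue_rV R d).
Local Open Scope ereal_scope.
Implicit Types C : set 'rV[R]_d.

Lemma eball_scale (c r : R) : (0 < c)%R ->
  mu (eball d (c * r)%R) = (c ^+ d)%:E * mu (eball d r).
Proof.
move=> c0; rewrite (lebesgue_rV_scale c0); last exact: measurable_eball.
congr (_ * mu _); apply/seteqP; split => x /=;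
  by rewrite /eball /= enormZ gtr0_norm// ler_pM2l.
Qed.

Lemma neighborhood_le (e1 e2 : R) C1 C2 : (e1 <= e2)%R -> C1 `<=` C2 ->
  neighborhood e1 C1 `<=` neighborhood e2 C2.
Proof.
by move=> e12 C12 x [a Ca xa]; exists a; [exact: C12|exact: lt_le_trans e12].
Qed.

Lemma sub_neighborhood (e : R) C : (0 < e)%R -> C `<=` neighborhood e C.
Proof. by move=> e0 x Cx; exists x; rewrite ?subrr ?enorm0. Qed.

(** With [l = p / (r + p)], the set [C + l B_(r+p)] is a convex combination, with
    weights [1 - l] and [l], of [q C] and of the ball [B_(r+p) = q B_r], where
    [q = (1 - l)^-1 = 1 + p / r]. Both dilates gain the factor [q ^+ d], and the
    remaining geometric mean of the volumes of [C] and [B_r] is at least that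
    of [C]. *)
Let bounded_neighborhood_ge (r p p' M : R) C :
  (0 < r)%R -> (0 < p < p')%R -> measurable C -> C `<=` box d M ->
  mu C <= mu (eball d r) ->
  ((1 + p / r) ^+ d)%:E * mu C <= mu (neighborhood p' C).
Proof.
move=> r0 /andP[p0 pp'] mC CM Cr.
have rp0 : (0 < r + p)%R by rewrite addr_gt0.
pose q := (1 + p / r)%R; pose l := (p / (r + p))%R.
have q0 : (0 < q)%R by rewrite ltr_wpDr// divr_ge0// ltW.
have l0 : (0 < l)%R by rewrite divr_gt0.
have lq : (1 - l = q^-1)%R.
  by rewrite /l /q; field; rewrite !gt_eqF.
have l1' : (0 < 1 - l)%R by rewrite lq invr_gt0.
have qr : (q * r = r + p)%R by rewrite /q; field; rewrite gt_eqF.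
pose A := [set x : 'rV[R]_d | C ((1 - l) *: x)%R].
have mA : measurable A by exact: measurable_scale_preimage.
have muC : mu C = ((1 - l) ^+ d)%:E * mu A by exact: lebesgue_rV_scale.
have muA : mu A = (q ^+ d)%:E * mu C.
  by rewrite muC muleA -EFinM lq -exprMn divff ?gt_eqF// expr1n mul1e.
have muB : mu (eball d (r + p)%R) = (q ^+ d)%:E * mu (eball d r).
  by rewrite -qr eball_scale.
have := @brunn_minkowski R d l (Num.max (q * M) (r + p))%R A (eball d (r + p)%R)
  (neighborhood p' C).
rewrite muA muB => /(_ _ mA (measurable_eball _) (measurable_neighborhood _ _)).
move=> BM.
have Cfin : mu C \is a fin_num.
  by rewrite ge0_fin_numE// (le_lt_trans Cr)// lebesgue_rV_eball.
have Bfin : mu (eball d r) \is a fin_num.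
  by rewrite ge0_fin_numE// lebesgue_rV_eball.
have qd0 : (0 <= q ^+ d)%R by rewrite exprn_ge0// ltW.
apply: le_trans (BM _ _ _ _).
- rewrite -(fineK Cfin) -(fineK Bfin) -!EFinM lee_fin /=.
  set c := fine (mu C); set b := fine _.
  have c0 : (0 <= c)%R by exact: fine_ge0.
  have cb : (c <= b)%R by apply: fine_le.
  have /esym Ec : (q ^+ d * c = (q ^+ d * c) `^ (1 - l) * (q ^+ d * c) `^ l)%R.
    by rewrite -powRD ?subrK ?oner_eq0// powRr1// mulr_ge0.
  rewrite -[leLHS]Ec; apply: ler_wpM2l; first exact: powR_ge0.
  have b0 : (0 <= b)%R by exact: fine_ge0.
  have qcb : (q ^+ d * c <= q ^+ d * b)%R by rewrite ler_wpM2l.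
  apply: ge0_ler_powR => //; rewrite ?nnegrE.
  - exact: ltW.
  - exact: mulr_ge0.
  - exact: mulr_ge0.
- by rewrite l0 -subr_gt0.
- move=> x /CM xM i; rewrite le_max; apply/orP; left.
  have := xM i; rewrite mxE normrM gtr0_norm// lq mulrC.
  by rewrite ler_pdivrMr// mulrC.
- by move=> x /eball_box xr i; rewrite le_max (xr i) orbT.
- move=> a b Aa Bb; exists ((1 - l) *: a)%R => //.
  rewrite addrC addKr enormZ gtr0_norm//; apply: le_lt_trans pp'.
  by rewrite /l mulrAC ler_pdivrMr// ler_pM2l.
Qed.

(** The Euclidean isoperimetric inequality: a set no larger than a ball grows at
    least at the rate of that ball. The gap between [p] and [p'] allows the
    use of closed balls against open neighborhoods. *)
Lemma lebesgue_neighborhood_ge (r p p' : R) C :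
  (0 < r)%R -> (0 < p < p')%R -> measurable C ->
  mu C <= mu (eball d r) ->
  ((1 + p / r) ^+ d)%:E * mu C <= mu (neighborhood p' C).
Proof.
move=> r0 pp' mC Cr; have /andP[p0 _] := pp'.
pose F k := C `&` box d k%:R.
have mF k : measurable (F k) by apply: measurableI => //; exact: measurable_box.
have UF : \bigcup_k F k = C.
  apply/seteqP; split => [x [k _ []]//|x Cx].
  exists (Num.truncn (enorm x)).+1 => //; split => // i.
  apply: le_trans (coord_le_enorm x i) _.
  by apply/ltW/truncnS_gt.
have ndF : nondecreasing_seq F.
  move=> m n mn; apply/subsetPset => x [Cx xm]; split => // i.
  by apply: le_trans (xm i) _; rewrite ler_nat.
have := nondecreasing_cvg_mu (mu := mu) mF.
rewrite UF => /(_ mC ndF) Fcvg.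
have q0 : (0 < (1 + p / r) ^+ d)%R.
  by rewrite exprn_gt0// ltr_wpDr// divr_ge0// ltW.
rewrite -lee_pdivlMl//.
rewrite -(cvg_lim _ Fcvg)//; apply: lime_le; first by apply/cvg_ex; exists (mu C).
apply: nearW => k; rewrite lee_pdivlMl//.
apply: (@le_trans _ _ (mu (neighborhood p' (F k)))).
  apply: (bounded_neighborhood_ge (M := k%:R)) => //; first by move=> x [].
  by apply: le_trans Cr; apply: le_measure; rewrite ?inE// => x [].
apply: le_measure; rewrite ?inE; try exact: measurable_neighborhood.
by apply: neighborhood_le => // x [].
Qed.

End euclidean_isoperimetry.

(** * Polar coordinates and radial displacement *)

Section polar.
Context (R : realType) (n : nat).
Local Notation leb := (@lebesgue_measure R).
Local Notation mu := (lebesgue_rV R n.+1).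
Local Notation E := 'rV[R]_n.+1.
Local Open Scope ereal_scope.

Lemma enorm_gt0 d (x : 'rV[R]_d) : (0 < enorm x)%R = (x != 0%R).
Proof.
rewrite lt_neqAle enorm_ge0 andbT eq_sym; congr (~~ _).
apply/eqP/eqP => [x0|->]; last exact: enorm0.
apply/rowP => i; rewrite mxE; apply/eqP.
by rewrite -normr_le0 -x0 coord_le_enorm.
Qed.

Let scaling (z : E * measurableTypeR R) : E := (z.2 *: z.1)%R.

Let measurable_scaling : measurable_fun setT scaling.
Proof.
apply: measurable_fun_mx => i j; under eq_fun do rewrite mxE.
apply: measurable_funM; first exact: measurable_snd.
exact: (measurableT_comp (@measurable_fun_mx_coord R 1 n.+1 i j)).
Qed.

(** The directions of polar coordinates are represented by the points of a shell
    instead of a sphere, so that they are integrated against volume itself. *)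
Let shell : set (E * measurableTypeR R) :=
  [set z | (0 < z.2)%R /\ (1 / 2 <= enorm z.1 <= 1)%R].

Let menorm1 : measurable_fun setT
  (fun z : E * measurableTypeR R => enorm z.1 : measurableTypeR R).
Proof. by apply: measurableT_comp; [exact: measurable_enorm|exact: measurable_fst]. Qed.

Let mpos2 : measurable [set z : E * measurableTypeR R | (0 < z.2)%R].
Proof.
rewrite (_ : mkset _ = snd @^-1` `]0%R, +oo[%classic).
  by rewrite -[X in measurable X]setTI; exact: measurable_snd.
by apply/seteqP; split => z; rewrite /= in_itv/= andbT.
Qed.

Let measurable_shell : measurable shell.
Proof.
rewrite (_ : shell = [set z | (0 < z.2)%R] `&` (fun z : E * measurableTypeR R =>
    enorm z.1 : measurableTypeR R) @^-1` `[(1 / 2)%R, 1%R]%classic).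
  apply: measurableI => //.
  by rewrite -[X in measurable X]setTI; exact: menorm1.
by apply/seteqP; split => z; rewrite /shell /= in_itv/=.
Qed.

(** The image of the shell under [(x, s) |-> (s *: x, s)]. *)
Let dyadic : set (E * measurableTypeR R) :=
  [set z | (0 < z.2)%R /\ (enorm z.1 <= z.2 <= 2 * enorm z.1)%R].

Let measurable_dyadic : measurable dyadic.
Proof.
rewrite (_ : dyadic = [set z | (0 < z.2)%R] `&`
    ([set z : E * measurableTypeR R | (enorm z.1 <= z.2)%R] `&`
     [set z | (z.2 <= 2 * enorm z.1)%R])).
  apply: measurableI => //; apply: measurableI; rewrite -[X in measurable X]setTI.
    exact: measurable_fun_le.
  by apply: measurable_fun_le => //; exact: measurable_funM.
apply/seteqP; split => z /=; first by move=> [? /andP[]].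
by move=> [? [? ?]]; split => //; apply/andP.
Qed.

(** On the shell, the Jacobian [s ^+ n.+1] of the dilation by [s], divided by the
    length [s * enorm x] of the set of factors by which some point of the shell
    on the same ray reaches [s *: x]. *)
Let weight (z : E * R) : R := (\1_shell z * (z.2 ^+ n * (enorm z.1) `^ (-1)))%R.

Let weight_ge0 z : (0 <= weight z)%R.
Proof.
rewrite /weight indicE; have [|_] := boolP (z \in shell); last by rewrite mul0r.
rewrite inE => -[z0 _]; rewrite mul1r mulr_ge0 ?powR_ge0//.
by rewrite exprn_ge0// ltW.
Qed.

Let mpow1 : measurable_fun setT
  (fun z : E * measurableTypeR R => (enorm z.1 `^ (-1))%R : measurableTypeR R).
Proof. exact: (@measurableT_comp _ _ _ _ _ _ (@powR R ^~ (-1)%R)). Qed.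

Let measurable_weight :
  measurable_fun setT (weight : E * measurableTypeR R -> measurableTypeR R).
Proof.
apply: measurable_funM; first exact: measurable_indic.
apply: measurable_funM => //; apply: measurable_funX; exact: measurable_snd.
Qed.

(** For each dilation factor [s] the
    substitution [y = s *: x] turns the right-hand side into an integral of
    [h y / enorm y] over the pairs [(y, s)] with
    [enorm y <= s <= 2 * enorm y]; integrating in [s] first multiplies by the
    length [enorm y] of that interval and leaves [h y]. The origin is missed,
    hence the hypothesis on [h 0]. *)
Lemma polar_integral (h : E -> \bar R) : measurable_fun setT h ->
  (forall x, 0 <= h x) -> h 0%R = 0 ->
  \int[mu]_y h y = \int[mu]_x \int[leb]_s ((weight (x, s))%:E * h (s *: x)%R).
Proof.
move=> mh h0 h00.
have mhs : measurable_fun setT (fun z : E * measurableTypeR R => h (z.2 *: z.1)%R).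
  exact: (measurableT_comp mh measurable_scaling).
rewrite (fubini_tonelli (fun z : E * measurableTypeR R =>
    (weight z)%:E * h (z.2 *: z.1)%R)); last 2 first.
- by apply: emeasurable_funM => //; exact/measurable_EFinP.
- by move=> z; rewrite mule_ge0// lee_fin.
pose G (z : E * measurableTypeR R) :=
  (\1_dyadic z * enorm z.1 `^ (-1))%:E * h z.1.
have mD : measurable_fun setT (fun z : E * measurableTypeR R =>
    (\1_dyadic z * enorm z.1 `^ (-1))%:E).
  apply/measurable_EFinP.
  by apply: measurable_funM; [exact: measurable_indic|exact: mpow1].
have mG : measurable_fun setT G.
  apply: emeasurable_funM; first exact: mD.
  exact: (measurableT_comp mh measurable_fst).
have G0 z : 0 <= G z.
  by rewrite /G mule_ge0// lee_fin mulr_ge0// powR_ge0.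
transitivity (\int[leb]_s \int[mu]_y G (y, s)); last first.
  apply: eq_integral => s _.
  have mGs : measurable_fun setT (fun y => G (y, s)).
    exact: (measurable_fun_pair1 s mG).
  have [s0|s0] := leP s 0%R.
    rewrite !integral0_eq// => x _.
      rewrite /weight indicE memNset ?mul0r ?mul0e//= => -[].
      by rewrite /= ltNge s0.
    rewrite /G indicE memNset ?mul0r ?mul0e//= => -[].
    by rewrite /= ltNge s0.
  (* After the dilation by s, the two integrands agree pointwise. *)
  have mGss : measurable_fun setT (fun x : E => G ((s *: x)%R, s)).
    exact: (measurableT_comp mGs (@measurable_fun_scale R n.+1 s)).
  have sn0 : (0 <= s ^+ n.+1)%R by rewrite exprn_ge0// ltW.
  have Gss0 (x : E) : setT x -> 0 <= G ((s *: x)%R, s) by move=> _; exact: G0.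
  rewrite (ge0_integral_scale s0 mGs (fun=> G0 _)).
  rewrite -(ge0_integralZl_EFin mu measurableT Gss0 mGss sn0).
  apply: eq_integral => x _.
  suff Ew : (s ^+ n.+1 * (\1_dyadic (s *: x, s) * enorm (s *: x) `^ (-1)) =
      weight (x, s))%R by rewrite /G muleA -EFinM Ew.
  rewrite /weight /= enormZ gtr0_norm// powRM ?enorm_ge0 ?ltW// powR_inv1 ?ltW//.
  rewrite (_ : \1_dyadic _ = \1_shell (x, s)).
    rewrite exprS; move: (\1_ _ _) (s ^+ n)%R (enorm x `^ _)%R => i sn e.
    by rewrite mulrCA; congr *%R; rewrite mulrACA divff ?gt_eqF// mul1r.
  rewrite !indicE; congr (nat_of_bool _)%:R; apply/idP/idP; rewrite !inE /=.
    move=> [_]; rewrite enormZ gtr0_norm// => /andP[xs sx]; split => //.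
    apply/andP; split; rewrite -(ler_pM2l s0) ?mulr1 //=.
    by move: sx => /=; move: (s * enorm x)%R => e; lra.
  move=> [_ /andP[x1 x2]]; split => //; rewrite enormZ gtr0_norm//.
  move: x1; rewrite -(ler_pM2l s0) /= => x1.
  move: x2; rewrite -(ler_pM2l s0) mulr1 /= => x2.
  move: x1 x2; move: (s * enorm x)%R => e x1 x2.
  by apply/andP; split; lra.
transitivity (\int[mu]_y \int[leb]_s G (y, s)); last exact: (fubini_tonelli G mG G0).
apply: eq_integral => y _.
have [->|y0] := eqVneq y 0%R.
  by rewrite h00 integral0_eq// => s _; rewrite /G h00 mule0.
have {}y0 : (0 < enorm y)%R by rewrite enorm_gt0.
rewrite /G /=.
rewrite ge0_integralZr//; last 2 first.
- exact: (measurable_fun_pair2 y mD).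
- by move=> s _; rewrite lee_fin mulr_ge0// powR_ge0.
rewrite (_ : \int[leb]_s _ = 1) ?mul1e//.
transitivity (\int[leb]_s ((enorm y `^ (-1))%:E *
    (\1_(`[enorm y, (2 * enorm y)%R]%classic : set R) s)%:E)).
  apply: eq_integral => s _; rewrite -EFinM mulrC; congr (_ * _)%:E.
  rewrite !indicE; congr (nat_of_bool _)%:R; apply/idP/idP; rewrite !inE /= in_itv//=.
    by move=> [].
  by move=> ys; split => //; case/andP: ys => /(lt_le_trans y0).
rewrite ge0_integralZl_EFin ?powR_ge0//; last first.
  exact/measurable_EFinP/measurable_indic.
rewrite integral_indic// setIT [X in _ * X]lebesgue_measure_itv/= lte_fin.
rewrite ltr_pMl// ltr1n powR_inv1 ?enorm_ge0// -EFinD -EFinM.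
by congr EFin; field; rewrite gt_eqF.
Qed.

Lemma measurable_origin : measurable [set 0%R : E].
Proof.
rewrite (_ : [set 0%R] = eball n.+1 0); first exact: measurable_eball.
apply/seteqP; split => x /=; first by move=> ->; rewrite /eball /= enorm0.
by rewrite /eball /= leNgt enorm_gt0 negbK => /eqP.
Qed.

(** The origin is invariant under the dilation by 2, which multiplies volumes by
    [2 ^+ n.+1]. *)
Lemma lebesgue_rV_origin : mu [set 0%R] = 0.
Proof.
have m0 := measurable_origin.
have fin0 : mu [set 0%R] \is a fin_num.
  rewrite ge0_fin_numE//; apply: le_lt_trans (@lebesgue_rV_eball R n.+1 0).
  apply: le_measure; rewrite ?inE//; first exact: measurable_eball.
  by move=> x ->; rewrite /eball /= enorm0.
have := @lebesgue_rV_scale R n.+1 2%R [set 0%R] (ltr0Sn R 1) m0.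
rewrite (_ : mkset _ = [set 0%R : E]); last first.
  apply/seteqP; split => x /=; last by move=> ->; rewrite scaler0.
  by move/eqP; rewrite scaler_eq0 pnatr_eq0/= => /eqP.
rewrite -(fineK fin0) -EFinM => -[] x0; congr EFin; apply/eqP.
have : ((2 ^+ n.+1 - 1) * fine (mu [set 0%R]) = 0)%R.
  by rewrite mulrBl mul1r -x0 subrr.
move/eqP; rewrite mulf_eq0 => /orP[|//]; rewrite subr_eq0 gt_eqF//.
by rewrite exprn_egt1// ltr1n.
Qed.

(** Moving every point outwards by the length [p] does not decrease integrals. In
    the coordinates of [polar_integral] the displacement is a translation
    [s |-> s + p / enorm x] on each ray, and the weight [s ^+ n] can only grow
    under it. *)
Lemma radial_push (p : R) (f h : E -> \bar R) : (0 <= p)%R ->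
  measurable_fun setT f -> measurable_fun setT h ->
  (forall x, 0 <= f x) -> (forall x, 0 <= h x) ->
  (forall x, x != 0%R -> f x <= h ((1 + p / enorm x) *: x)%R) ->
  \int[mu]_x f x <= \int[mu]_x h x.
Proof.
move=> p0 mf mh f0 h0 fh.
pose D : set E := [set: E] `\` [set 0%R].
have mDo : measurable D by apply: measurableD => //; exact: measurable_origin.
have stripE (k : E -> \bar R) (mk : measurable_fun setT k) (k0 : forall x, 0 <= k x) :
    \int[mu]_x k x = \int[mu]_x (k \_ D) x.
  rewrite (ge0_negligible_integral measurable_origin)//; last exact: lebesgue_rV_origin.
  by rewrite integral_mkcond.
have mstrip (k : E -> \bar R) : measurable_fun setT k -> measurable_fun setT (k \_ D).
  move=> mk; apply/(measurable_restrictT _ mDo); exact: measurable_funTS.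
have strip0 (k : E -> \bar R) : (forall x, 0 <= k x) -> forall x, 0 <= (k \_ D) x.
  by move=> k0; exact: erestrict_ge0.
have strip00 (k : E -> \bar R) : (k \_ D) 0%R = 0 :> \bar R.
  by rewrite patchE memNset// => -[_ /(_ erefl)].
have stripD (k : E -> \bar R) x : x != 0%R -> (k \_ D) x = k x :> \bar R.
  by move=> x0; rewrite patchE mem_set//; split => //=; apply/eqP.
rewrite (stripE f mf f0) (stripE h mh h0).
rewrite (polar_integral (mstrip f mf) (strip0 f f0) (strip00 f)).
rewrite (polar_integral (mstrip h mh) (strip0 h h0) (strip00 h)).
have mw (k : E -> \bar R) (mk : measurable_fun setT k) : measurable_fun setT
    (fun z : E * measurableTypeR R => (weight z)%:E * k (z.2 *: z.1)%R).
  apply: emeasurable_funM; first exact/measurable_EFinP.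
  exact: (measurableT_comp mk measurable_scaling).
have w0 (k : E -> \bar R) (k0 : forall x, 0 <= k x) z : 0 <= (weight z)%:E * k (z.2 *: z.1)%R.
  by rewrite mule_ge0// lee_fin.
have mf' := mw _ (mstrip f mf); have mh' := mw _ (mstrip h mh).
have f0' := w0 _ (strip0 f f0); have h0' := w0 _ (strip0 h h0).
apply: ge0_le_integral => //.
- by move=> x _; apply: integral_ge0 => s _; exact: (f0' (x, s)).
- exact: (measurable_fun_fubini_tonelli_F _ mf' f0').
- exact: (measurable_fun_fubini_tonelli_F _ mh' h0').
move=> x _; have [->|x0] := eqVneq x 0%R.
  rewrite integral0_eq => [|s _]; last by rewrite scaler0 strip00 mule0.
  by apply: integral_ge0 => s _; exact: (h0' (0%R, s)).
have ex0 : (0 < enorm x)%R by rewrite enorm_gt0.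
have px0 : (0 <= p / enorm x)%R by rewrite divr_ge0// enorm_ge0.
have mfx : measurable_fun setT (fun s : measurableTypeR R =>
    (weight (x, s))%:E * (f \_ D) (s *: x)%R).
  exact: (measurable_fun_pair2 x mf').
have mhx : measurable_fun setT (fun s : measurableTypeR R =>
    (weight (x, s))%:E * (h \_ D) (s *: x)%R).
  exact: (measurable_fun_pair2 x mh').
rewrite [leRHS](ge0_integral_affine (p / enorm x) ltr01 mhx (fun s => h0' (x, s))).
have mshift : measurable_fun setT
    ((fun s => 1 * s + p / enorm x)%R : measurableTypeR R -> measurableTypeR R).
  by apply: measurable_funD => //; exact: measurable_funM.
have mhx' := measurableT_comp mhx mshift.
have fx0 (s : R) : setT s -> 0 <= (weight (x, s))%:E * (f \_ D) (s *: x)%R.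
  by move=> _; exact: (f0' (x, s)).
rewrite mul1e; apply: (ge0_le_integral leb measurableT fx0 mfx mhx').
move=> s _; rewrite /= mul1r; have [s0|s0] := leP s 0%R.
  rewrite /weight [\1_ _ _]indicE memNset ?mul0r ?mul0e; first exact: (h0' (x, _)).
  by move=> [] /=; rewrite ltNge s0.
have sp0 : (0 < s + p / enorm x)%R by rewrite ltr_wpDr.
apply: lee_pmul => //; first by rewrite lee_fin.
- exact: strip0.
- rewrite lee_fin /weight !indicE (_ : (x, s) \in _ = ((x, (s + p / enorm x)%R) \in shell)).
    have [_|_] := boolP ((x, (s + p / enorm x)%R) \in shell); rewrite ?mul0r// !mul1r ler_wpM2r ?powR_ge0//=.
    by rewrite lerXn2r ?nnegrE ?(ltW s0) ?(ltW sp0)// lerDl.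
  by apply/idP/idP; rewrite !inE => -[? ?].
- have sx0 : (s *: x)%R != 0%R by rewrite scaler_eq0 negb_or gt_eqF.
  have spx0 : ((s + p / enorm x) *: x)%R != 0%R by rewrite scaler_eq0 negb_or gt_eqF.
  rewrite !stripD//; apply: le_trans (fh _ sx0) _.
  rewrite scalerA enormZ gtr0_norm//.
  rewrite (_ : ((1 + _) * s = s + p / enorm x)%R)//.
  by field; rewrite !gt_eqF.
Qed.

End polar.

(** * Elementary estimates and the bathtub principle *)

Section auxiliary_facts.
Context (R : realType).

Lemma sin_lt_id (x : R) : 0 < x < pi -> sin x < x.
Proof.
move=> /andP[x0 xpi].
have csin : {within `[0, x], continuous (@sin R)}.
  by apply: continuous_subspaceT => y; exact: continuous_sin.
have [c] := MVT x0 (fun y _ => is_derive_sin y) csin.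
rewrite in_itv/= sin0 !subr0 => /andP[c0 cx] ->.
have c_pi : c \in `[0, pi] by rewrite in_itv/= (ltW c0) (ltW (lt_trans cx xpi)).
have zero_pi : (0 : R) \in `[0, pi] by rewrite in_itv/= lexx pi_ge0.
by rewrite gtr_pMl// -(@cos0 R) ltr_cos.
Qed.

(** Since [cos (pi / 2) = 0], the square of [sin (pi / 4)] is 1/2, while
    [sin x < x] for [x = pi / 4]. *)
Lemma sqr_pi_gt8 : 8 < pi ^+ 2 :> R.
Proof.
have p4 : 0 < pi / 4 :> R by rewrite divr_gt0// pi_gt0.
have s0 : 0 < sin (pi / 4 : R).
  apply: sin_gt0_pi; rewrite p4/=; have := pi_gt0 R; lra.
have : sin (pi / 4 : R) < pi / 4.
  by apply: sin_lt_id; rewrite p4/=; have := pi_gt0 R; lra.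
move=> s4; have : sin (pi / 4 : R) ^+ 2 < (pi / 4) ^+ 2.
  by rewrite ltr_pXn2r// nnegrE ltW.
have := cos_mulr2n (pi / 4 : R).
rewrite (_ : (pi / 4) *+ 2 = pi / 2); last by rewrite mulr2n; field.
rewrite cos_pihalf sin2cos2 mulr2n.
move: (cos _ ^+ 2) => c; move: (pi : R) => p; rewrite expr_div_n; lra.
Qed.

Lemma exprn_sub1_le (x : R) n : 0 <= x ->
  (1 + x) ^+ n - 1 <= n%:R * x * (1 + x) ^+ n.
Proof.
move=> x0; elim: n => [|n IH]; first by rewrite expr0 subrr !mul0r.
have q1 : 1 <= (1 + x) ^+ n by rewrite exprn_ege1// lerDl.
rewrite exprS -natr1; set q := (1 + x) ^+ n in IH q1 *.
have : 0 <= n%:R :> R by []; move: (n%:R : R) IH => m; nra.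
Qed.

Lemma exprn_sub1_ge (x : R) n : 0 <= x -> n%:R * x <= (1 + x) ^+ n - 1.
Proof.
move=> x0; elim: n => [|n IH]; first by rewrite expr0 subrr !mul0r.
rewrite exprS -natr1; set q := (1 + x) ^+ n in IH *.
have : 0 <= n%:R :> R by []; move: (n%:R : R) IH => m; nra.
Qed.

Local Open Scope ereal_scope.

(** A lower limit at 0 does not see a rescaling of its variable, so the two
    functions may be compared at proportional points. *)
Lemma limf_einf_at_right_rescale (F G : R -> \bar R) (K theta e0 : R) :
  (0 < K)%R -> (0 < theta)%R -> (0 < e0)%R ->
  (forall e, (0 < e < e0)%R -> F (theta * e)%R <= K%:E * G e) ->
  limf_einf F 0%R^'+ <= K%:E * limf_einf G 0%R^'+.
Proof.
move=> K0 t0 e00 FG; rewrite !limf_einfE.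
apply: ge_ereal_sup => _ [V V0 <-].
rewrite muleC -lee_pdivrMr//.
apply: le_ereal_sup_tmp.
exists (ereal_inf (G @` [set e | (0 < e < e0)%R /\ V (theta * e)%R])).
  exists [set e | (0 < e < e0)%R /\ V (theta * e)%R] => //.
  have [eta /= eta0 Hv] := V0.
  exists (Num.min e0 (eta / theta))%R => /=.
    by rewrite lt_min e00 divr_gt0.
  move=> e; rewrite /= sub0r normrN lt_min => /andP[ee0 eeta] e_gt0.
  move: ee0 eeta; rewrite gtr0_norm// => ee0 eeta; split; first by rewrite e_gt0.
  apply: Hv => /=; last by rewrite mulr_gt0.
  by rewrite sub0r normrN gtr0_norm ?mulr_gt0// mulrC -ltr_pdivlMr.
apply: le_ereal_inf_tmp => _ [e [ee Ve] <-].
rewrite lee_pdivrMr// muleC; apply: le_trans (FG _ ee).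
by apply: ereal_inf_lbound; exists (theta * e)%R.
Qed.

End auxiliary_facts.

Section bathtub.
Context d (T : measurableType d) (R : realType).
Variable mu : {measure set T -> \bar R}.
Local Open Scope ereal_scope.

(** The common part of [A] and [B] cancels, and the two differences have the same
    [f]-mass. The density of [g] with respect to [f] is at least [c] on the one
    and at most [c] on the other. *)
Lemma bathtub (A B : set T) (f g : T -> \bar R) (c : R) :
  measurable A -> measurable B -> (0 <= c)%R ->
  measurable_fun setT f -> measurable_fun setT g ->
  (forall x, 0 <= f x) -> (forall x, 0 <= g x) ->
  \int[mu]_(x in A) f x = \int[mu]_(x in B) f x ->
  \int[mu]_(x in B) f x < +oo ->
  (forall x, A x -> ~ B x -> c%:E * f x <= g x) ->
  (forall x, B x -> ~ A x -> g x <= c%:E * f x) ->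
  \int[mu]_(x in B) g x <= \int[mu]_(x in A) g x.
Proof.
move=> mA mB c0 mf mg f0 g0 AB Boo cA cB.
have split2 X Y k : measurable X -> measurable Y -> measurable_fun setT k ->
    (forall x, 0 <= k x) ->
    \int[mu]_(x in X) k x = \int[mu]_(x in X `&` Y) k x + \int[mu]_(x in X `\` Y) k x.
  move=> mX mY mk k0; rewrite -[in LHS](setUIDK X Y) ge0_integral_setU//.
  - exact: measurableI.
  - exact: measurableD.
  - exact: measurable_funTS.
  - by apply/disj_setPS => x [[_ ?] []].
have mAB : measurable (A `\` B) by exact: measurableD.
have mBA : measurable (B `\` A) by exact: measurableD.
have fD : \int[mu]_(x in A `\` B) f x = \int[mu]_(x in B `\` A) f x.
  have fin : \int[mu]_(x in B `&` A) f x \is a fin_num.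
    rewrite ge0_fin_numE; last by apply: integral_ge0.
    apply: le_lt_trans Boo; apply: ge0_subset_integral => //.
    - exact: measurableI.
    - exact: measurable_funTS.
  move: AB; rewrite (split2 A B f)// (split2 B A f)// [A `&` B]setIC.
  move=> /(congr1 (fun y => y - \int[mu]_(x in B `&` A) f x)).
  by rewrite ![_ + \int[mu]_(x in _ `\` _) _]addeC !addeK.
rewrite (split2 A B g)// (split2 B A g)// [B `&` A]setIC leeD2l//.
apply: (@le_trans _ _ (\int[mu]_(x in B `\` A) (c%:E * f x))).
  apply: ge0_le_integral => //.
  - exact: measurable_funTS.
  - by apply: measurable_funTS; exact: measurable_funeM.
  - by move=> x [Bx Ax]; exact: cB.
rewrite ge0_integralZl_EFin//; last exact: measurable_funTS.
rewrite -fD -ge0_integralZl_EFin//; last exact: measurable_funTS.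
apply: ge0_le_integral => //.
- by move=> x _; rewrite mule_ge0.
- by apply: measurable_funTS; exact: measurable_funeM.
- exact: measurable_funTS.
- by move=> x [Ax Bx]; exact: cA.
Qed.

End bathtub.

(** * Growth of sets for a radial weight *)

Section radial_weight.
Context (R : realType) (n : nat) (w : R -> R).
Hypothesis w_gt0 : forall s, 0 < w s.
Hypothesis w_nd : forall s t, 0 <= s -> s <= t -> w s <= w t.
Local Notation d := n.+1.
Local Notation leb := (@lebesgue_measure R).
Local Notation L := (lebesgue_rV R d).
Local Open Scope ereal_scope.
Implicit Types A B E T : set 'rV[R]_d.

(** Only the values of [w] on nonnegative reals matter, and there [w] coincides
    with a function that is nondecreasing on the whole line. *)
Lemma measurable_radial (p : R) : (0 <= p)%R ->
  measurable_fun setT (fun x : 'rV[R]_d => (w (enorm x + p))%:E).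
Proof.
move=> p0; apply/measurable_EFinP.
pose w' (s : R) := w (Num.max s 0)%R.
rewrite (_ : (fun _ => _) = w' \o (fun x => enorm x + p)%R); last first.
  by apply/funext => x; rewrite /w' /= max_l// addr_ge0// enorm_ge0.
apply: (@measurableT_comp _ _ _ _ _ _ (w' : measurableTypeR R -> measurableTypeR R)).
  apply: nondecreasing_measurable => // s t st; apply: w_nd.
    by rewrite le_max lexx orbT.
  by rewrite ge_max !le_max st lexx orbT.
by apply: measurable_funD => //; exact: measurable_enorm.
Qed.

Let mw : measurable_fun setT (fun x : 'rV[R]_d => (w (enorm x))%:E).
Proof.
have := measurable_radial (lexx 0%R).
by under eq_fun do rewrite addr0.
Qed.

Let wE_ge0 s : 0 <= (w s)%:E. Proof. by rewrite lee_fin ltW. Qed.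

Lemma integral_radial_push E T (p : R) : (0 <= p)%R ->
  measurable E -> measurable T ->
  (forall x y, E x -> (enorm (y - x) <= p)%R -> T y) ->
  \int[L]_(x in E) (w (enorm x + p))%:E <= \int[L]_(x in T) (w (enorm x))%:E.
Proof.
move=> p0 mE mT ET; rewrite (integral_mkcond E) (integral_mkcond T).
apply: (radial_push p0).
- by apply/(measurable_restrictT _ mE); apply: measurable_funTS; exact: measurable_radial.
- by apply/(measurable_restrictT _ mT); exact: measurable_funTS.
- by apply: erestrict_ge0.
- by apply: erestrict_ge0.
move=> x x0; rewrite !patchE; case: ifPn => [|_]; last by case: ifPn.
rewrite inE => Ex.
have ex0 : (0 < enorm x)%R by rewrite enorm_gt0.
have xp0 : (0 <= p / enorm x)%R by rewrite divr_ge0// ltW.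
rewrite mem_set; last first.
  apply: (ET x) => //; rewrite scalerDl scale1r addrC addKr enormZ ger0_norm//.
  by rewrite divfK// gt_eqF.
rewrite enormZ ger0_norm; last by rewrite addr_ge0.
by rewrite mulrDl mul1r divfK// gt_eqF.
Qed.

Lemma integral_ball_dilate (r p : R) : (0 < r)%R -> (0 <= p)%R ->
  \int[L]_(x in eball d (r + p)%R) (w (enorm x))%:E <=
  ((1 + p / r) ^+ d)%:E * \int[L]_(x in eball d r) (w (enorm x + p))%:E.
Proof.
move=> r0 p0; have pr0 : (0 <= p / r)%R by rewrite divr_ge0// ltW.
have c0 : (0 < 1 + p / r)%R by rewrite ltr_wpDr.
have mB s : measurable (eball d s : set 'rV[R]_d) by exact: measurable_eball.
rewrite integral_mkcond (integral_mkcond (eball d r)).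
have mf : measurable_fun setT
    ((fun x : 'rV[R]_d => (w (enorm x))%:E) \_ (eball d (r + p)%R)).
  by apply/(measurable_restrictT _ (mB _)); exact: measurable_funTS.
rewrite (ge0_integral_scale c0 mf); last by apply: erestrict_ge0.
apply: lee_pmul => //.
- by rewrite lee_fin exprn_ge0// ltW.
- by apply: integral_ge0 => x _; apply: erestrict_ge0.
apply: ge0_le_integral => //.
- by move=> x _; apply: erestrict_ge0.
- exact: (measurableT_comp mf (@measurable_fun_scale R d _)).
- apply/(measurable_restrictT _ (mB _)); apply: measurable_funTS.
  exact: measurable_radial.
move=> x _; rewrite !patchE; case: ifPn => [|_]; last by case: ifPn.
rewrite inE /eball /= enormZ gtr0_norm// => xr.
have {}xr : (enorm x <= r)%R.
  rewrite -(ler_pM2l c0); apply: le_trans xr _.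
  by rewrite mulrDl mul1r divfK// gt_eqF.
rewrite mem_set// lee_fin; apply: w_nd.
  by rewrite mulr_ge0 ?enorm_ge0// ltW.
rewrite mulrDl mul1r lerD2l mulrAC ler_pdivrMr//.
by rewrite ler_wpM2l.
Qed.

(** The isoperimetric inequality for the weight [w], at the cost of evaluating it
    at [enorm x + e]: an enlargement by less than [e] lowers the norm by less
    than [e], so the enlargement of each superlevel set
    [A `&` [set x | t < w (enorm x)]] stays in the superlevel set of the
    shifted weight. These sets are no larger than the ball, and the layer cake
    formula integrates their Euclidean growth over [t]. *)
Lemma radial_neighborhood_ge A (r q e : R) : (0 < r)%R -> (0 < q < e)%R ->
  measurable A -> L A <= L (eball d r) ->
  ((1 + q / r) ^+ d)%:E * \int[L]_(x in A) (w (enorm x))%:E <=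
  \int[L]_(x in neighborhood e A) (w (enorm x + e))%:E.
Proof.
move=> r0 qe mA Ar; have /andP[q0 qe'] := qe.
have e0 : (0 < e)%R by exact: lt_trans qe'.
have mN : measurable (neighborhood e A) by exact: measurable_neighborhood.
rewrite (integral_mkcond A) (integral_mkcond (neighborhood e A)).
set f := _ \_ A; set g := _ \_ _.
have mf : measurable_fun setT f.
  by apply/(measurable_restrictT _ mA); exact: measurable_funTS.
have mg : measurable_fun setT g.
  apply/(measurable_restrictT _ mN); apply: measurable_funTS.
  by apply: measurable_radial; exact: ltW.
have f0 x : 0 <= f x by apply: erestrict_ge0.
have g0 x : 0 <= g x by apply: erestrict_ge0.
rewrite (layer_cake L mf f0) (layer_cake L mg g0).
have Q0 : (0 <= (1 + q / r) ^+ d)%R.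
  by rewrite exprn_ge0// addr_ge0// divr_ge0// ltW.
have mLf := measurable_fun_level L mf; have mLg := measurable_fun_level L mg.
rewrite -(ge0_integralZl_EFin leb measurableT _ mLf Q0)//.
apply: (ge0_le_integral leb measurableT _ _ mLg) => //.
- by move=> t _; rewrite mule_ge0.
- exact: measurable_funeM.
move=> t _.
apply: le_trans (lebesgue_neighborhood_ge r0 qe (measurable_level mf t) _) _.
  apply: le_trans Ar; apply: le_measure; rewrite ?inE//; first exact: measurable_level.
  move=> x /= [t0]; rewrite /f patchE; case: ifPn; first by rewrite inE.
  by move=> _; rewrite ltNge lee_fin ltW.
apply: le_measure; rewrite ?inE; [exact: measurable_neighborhood|exact: measurable_level|].
move=> y [x /= [t0 tf] yx]; split => //.
move: tf; rewrite /f /g !patchE; case: ifPn; last first.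
  by move=> _; rewrite ltNge lee_fin ltW.
rewrite inE => Ax tw; rewrite mem_set; last by exists x.
apply: lt_le_trans tw _; rewrite lee_fin; apply: w_nd; first exact: enorm_ge0.
rewrite -[x](subrK y); apply: le_trans (enorm_triangle _ _) _.
by rewrite addrC lerD2l -enormN opprB ltW.
Qed.

Hypothesis w_log_convex : forall s t p : R, (0 <= s)%R -> (s <= t)%R -> (0 <= p)%R ->
  (w (s + p) * w t <= w s * w (t + p))%R.

Local Notation mu A := (\int[L]_(x in A) (w (enorm x))%:E).

Lemma mu_ball_fin r : (0 <= r)%R -> mu (eball d r) < +oo.
Proof.
move=> r0.
apply: (@le_lt_trans _ _ (\int[L]_(x in eball d r) (cst (w r)%:E) x)).
  apply: ge0_le_integral => //; first exact: measurable_eball.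
  - exact: measurable_funTS.
  - by move=> x xr; rewrite lee_fin; apply: w_nd => //; exact: enorm_ge0.
rewrite integral_cst; last exact: measurable_eball.
by rewrite lte_mul_pinfty// lebesgue_rV_eball.
Qed.

(** The weight is at most [w r] inside the ball and at least [w r] outside, so for
    a given mass the ball has the largest volume. *)
Lemma volume_le_ball A (r : R) : (0 <= r)%R -> measurable A ->
  mu A = mu (eball d r) -> L A <= L (eball d r).
Proof.
move=> r0 mA Am; have mB := @measurable_eball R d r.
have -> : L A = \int[L]_(x in A) cst 1 x by rewrite integral_cst// mul1e.
have -> : L (eball d r) = \int[L]_(x in eball d r) cst 1 x.
  by rewrite integral_cst// mul1e.
apply: (@bathtub _ _ _ L _ _ (fun x => (w (enorm x))%:E) (cst 1) (w r)^-1) => //.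
- by rewrite invr_ge0 ltW.
- by rewrite Am mu_ball_fin.
- move=> x xr _; rewrite -EFinM lee_fin mulrC ler_pdivrMr// mul1r.
  by apply: w_nd => //; exact: enorm_ge0.
- move=> x _ xr; have rx : (r < enorm x)%R by rewrite ltNge; exact/negP.
  rewrite -EFinM lee_fin mulrC ler_pdivlMr// mul1r.
  by apply: w_nd => //; exact: ltW.
Qed.

(** The ratio [w (s + p) / w s] is nondecreasing in [s], so for a given mass the
    shift by [p] gains the least on the ball. *)
Lemma shifted_mass_ge_ball A (r p : R) : (0 <= r)%R -> (0 <= p)%R ->
  measurable A -> mu A = mu (eball d r) ->
  \int[L]_(x in eball d r) (w (enorm x + p))%:E <=
  \int[L]_(x in A) (w (enorm x + p))%:E.
Proof.
move=> r0 p0 mA Am; have mB := @measurable_eball R d r.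
apply: (@bathtub _ _ _ L _ _ (fun x => (w (enorm x))%:E) _ (w (r + p) / w r)%R) => //.
- by rewrite divr_ge0// ltW.
- exact: measurable_radial.
- exact: mu_ball_fin.
- move=> x _ xr; have rx : (r < enorm x)%R by rewrite ltNge; exact/negP.
  rewrite -EFinM lee_fin mulrAC ler_pdivrMr// [leRHS]mulrC.
  by apply: w_log_convex => //; exact: ltW.
- move=> x xr _; rewrite -EFinM lee_fin mulrAC ler_pdivlMr//.
  rewrite [leRHS]mulrC; apply: w_log_convex => //; exact: enorm_ge0.
Qed.

Lemma mass_le_neighborhood A (e : R) : (0 < e)%R -> measurable A ->
  mu A <= mu (neighborhood e A).
Proof.
move=> e0 mA; apply: ge0_subset_integral => //.
- exact: measurable_neighborhood.
- exact: measurable_funTS.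
- exact: sub_neighborhood.
Qed.

(** The comparison at a fixed scale. The set [A] is enlarged by [delta] and the
    ball only by [p = theta * delta]: the difference makes room for
    displacements by exactly [p] inside open neighborhoods. *)
Lemma radial_increment_le A (r delta theta : R) :
  (0 < r)%R -> (0 < delta)%R -> (0 < theta < 1)%R ->
  measurable A -> mu A = mu (eball d r) ->
  mu (neighborhood (theta * delta)%R (eball d r)) - mu (eball d r) <=
  (3 * (1 + theta * delta / r) ^+ d)%:E * (mu (neighborhood delta A) - mu A).
Proof.
move=> r0 dl0 /andP[t0 t1] mA Am.
set p := (theta * delta)%R.
have p0 : (0 < p)%R by rewrite mulr_gt0.
have pd : (p < delta)%R by rewrite gtr_pMl.
set D := \int[L]_(x in eball d r) (w (enorm x + p))%:E.
have mN e (B : set 'rV[R]_d) : measurable (neighborhood e B).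
  exact: measurable_neighborhood.
(* The radial displacement by p, followed by the comparison with the ball. *)
have aD : D <= mu (neighborhood delta A).
  apply: le_trans (shifted_mass_ge_ball (ltW r0) (ltW p0) mA Am) _.
  apply: integral_radial_push => //; first exact: ltW.
  by move=> x y Ax xy; exists x => //; exact: le_lt_trans pd.
(* Half of delta is spent on an enlargement, half on a radial displacement. *)
have aQ : ((1 + p / 2 / r) ^+ d)%:E * mu A <= mu (neighborhood delta A).
  apply: le_trans (radial_neighborhood_ge (e := (delta / 2)%R) r0 _ mA _) _.
  - by rewrite divr_gt0//= ltr_pM2r.
  - exact: volume_le_ball (ltW r0) mA Am.
  apply: integral_radial_push => //; first by rewrite divr_ge0// ltW.
  move=> x y [a Aa xa] yx; exists a => //.
  rewrite (_ : y - a = (y - x) + (x - a))%R; last by rewrite addrA subrK.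
  apply: le_lt_trans (enorm_triangle _ _) _.
  by rewrite [ltRHS]splitr ler_ltD.
have bD : mu (neighborhood p (eball d r)) <= ((1 + p / r) ^+ d)%:E * D.
  apply: le_trans (integral_ball_dilate r0 (ltW p0)).
  apply: ge0_subset_integral => //; first exact: measurable_eball.
  - exact: measurable_funTS.
  - move=> x [y yr xy]; rewrite /eball /= -[x](subrK y).
    apply: le_trans (enorm_triangle _ _) _.
    by rewrite addrC lerD// ltW.
have q1 : (1 <= (1 + p / r) ^+ d)%R.
  by rewrite exprn_ege1// lerDl divr_ge0// ltW.
have q0 : (0 < (1 + p / r) ^+ d)%R by exact: lt_le_trans q1.
have Bfin : mu (eball d r) \is a fin_num.
  by rewrite ge0_fin_numE; [exact: mu_ball_fin (ltW r0)|exact: integral_ge0].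
have [Noo|] := eqVneq (mu (neighborhood delta A)) +oo.
  rewrite Noo Am addye; last by move: Bfin; rewrite -fin_numN fin_numE => /andP[].
  by rewrite gt0_muley ?leey// lte_fin mulr_gt0.
rewrite -ltey => Nlt.
have N0 : 0 <= mu (neighborhood delta A) by exact: integral_ge0.
have Nfin : mu (neighborhood delta A) \is a fin_num by rewrite ge0_fin_numE.
have D0 : 0 <= D by exact: integral_ge0.
have Dfin : D \is a fin_num by rewrite ge0_fin_numE// (le_lt_trans aD).
have b0 : 0 <= mu (neighborhood p (eball d r)) by exact: integral_ge0.
have bfin : mu (neighborhood p (eball d r)) \is a fin_num.
  rewrite ge0_fin_numE//; apply: le_lt_trans bD _.
  apply: lte_mul_pinfty => //; first by rewrite lee_fin ltW.
  by rewrite ltey_eq Dfin.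
have m0 : (0 <= fine (mu (eball d r)))%R by apply: fine_ge0; exact: integral_ge0.
move: aD aQ bD; rewrite Am.
rewrite -(fineK Nfin) -(fineK Dfin) -(fineK bfin) -(fineK Bfin).
rewrite -!EFinM -!EFinB -?EFinM !lee_fin.
set m := fine (mu (eball d r)) in m0 *; set D' := fine D.
set a := fine (mu (neighborhood delta A)).
set b := fine (mu (neighborhood p (eball d r))).
clearbody m D' a b => aD aQ bD.
have pr0 : (0 <= p / r)%R by rewrite divr_ge0// ltW.
have pr2 : (0 <= p / 2 / r)%R by rewrite mulrAC divr_ge0.
have Q1 := exprn_sub1_ge d pr2.
have Q2 := exprn_sub1_le d pr0.
rewrite [(p / 2 / r)%R]mulrAC in Q1 aQ.
move: q0 Q1 Q2 aQ bD; move: ((1 + p / r) ^+ d)%R ((1 + p / r / 2) ^+ d)%R => q q2.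
move: (d%:R) (p / r)%R => N y q0 Q1 Q2 aQ bD.
have am : (N * y * m <= 2 * (a - m))%R.
  have : (N * (y / 2) * m <= (q2 - 1) * m)%R by exact: ler_wpM2r.
  move: aQ; rewrite mulrBl mul1r; lra.
have : (q * D' <= q * a)%R by rewrite ler_pM2l.
have : ((q - 1) * m <= N * y * q * m)%R by exact: ler_wpM2r.
have : (q * (N * y * m) <= q * (2 * (a - m)))%R by rewrite ler_pM2l.
move: bD; rewrite mulrBl mul1r !mulrBr; lra.
Qed.

End radial_weight.

(** * Convex potentials *)

Section convex_potential.
Context (R : realType) (v : R -> R).
Hypothesis v_convex : convex_function (E := R^o) `[0, +oo[ v.

Lemma convex_combination_le (a s t : R) : 0 <= a <= 1 -> 0 <= s -> 0 <= t ->
  v (a * s + (1 - a) * t) <= a * v s + (1 - a) * v t.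
Proof.
move=> /andP[a0 a1] s0 t0.
have a01 : Itv.spec (@Itv.num_sem R) (Itv.Real `[0%Z, 1%Z]) a.
  by rewrite /Itv.spec /= /Itv.num_sem /= num_real in_itv/= a0 a1.
have := v_convex (Itv.mk a01).
move=> /(_ s t); rewrite !inE /= !in_itv/= !andbT s0 t0 => /(_ isT isT).
by rewrite !convRE.
Qed.

(** Both [s + p] and [t] are convex combinations of [s] and [t + p], with
    exchanged weights. *)
Lemma convex_increment_le (s t p : R) : 0 <= s -> s <= t -> 0 <= p ->
  v (s + p) + v t <= v s + v (t + p).
Proof.
move=> s0 st p0; have [D0|D0] := eqVneq (t + p - s) 0.
  have -> : p = 0 by lra.
  by rewrite !addr0; have -> : t = s by lra.
have {}D0 : 0 < t + p - s by rewrite lt_neqAle eq_sym D0/= -addrAC addr_ge0// subr_ge0.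
pose a := p / (t + p - s).
have a01 : 0 <= a <= 1.
  by rewrite divr_ge0 ?(ltW D0)//= ler_pdivrMr// mul1r; lra.
have a01' : 0 <= 1 - a <= 1 by lra.
have tp0 : 0 <= t + p by lra.
have aD : a * (t + p - s) = p by rewrite divfK ?gt_eqF.
have := convex_combination_le a01 s0 tp0.
have := convex_combination_le a01' s0 tp0.
rewrite (_ : a * s + (1 - a) * (t + p) = t); last first.
  by rewrite -[RHS](addrK p) -[X in _ = _ - X]aD; ring.
rewrite (_ : (1 - a) * s + (1 - (1 - a)) * (t + p) = s + p); last first.
  by rewrite -[X in _ = _ + X]aD; ring.
lra.
Qed.

End convex_potential.

Theorem theorem6p10 (R : realType) (d : nat) (v : R -> R) (r : R)
    (A : set 'rV[R]_d)
  (d_gt0 : (0 < d)%N)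
  (v_convex : convex_function (E := R^o) `[0, +oo[ v)
  (v_increasing : {in `[0, +oo[ &, {homo v : s t / s <= t}})
  (r_gt0 : 0 < r)
  (A_borel : measurable A)
  (A_mass : radial_measure d v A = radial_measure d v (eball d r)) :
  ((1 / Num.sqrt (1 + pi ^+ 2))%:E *
      surface_measure (radial_measure d v) (eball d r)
   <= surface_measure (radial_measure d v) A)%E.
Proof.
case: d A d_gt0 A_borel A_mass => // n A _ A_borel A_mass.
pose w (s : R) := expR (v s).
have w_gt0 s : 0 < w s by exact: expR_gt0.
have w_nd s t : 0 <= s -> s <= t -> w s <= w t.
  move=> s0 st; rewrite ler_expR; apply: v_increasing => //.
    by rewrite in_itv/= andbT.
  by rewrite in_itv/= andbT (le_trans s0).
have w_lc (s t p : R) : 0 <= s -> s <= t -> 0 <= p ->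
    w (s + p) * w t <= w s * w (t + p).
  by move=> s0 st p0; rewrite -!expRD ler_expR; exact: convex_increment_le.
set K := Num.sqrt (1 + pi ^+ 2).
have K3 : 3 < K.
  rewrite -[ltLHS]gtr0_norm// -sqrtr_sqr ltr_sqrt; last first.
    by rewrite ltr_wpDr// sqr_ge0.
  have := sqr_pi_gt8 R; lra.
have K0 : 0 < K by lra.
(* Any ratio strictly between 3 / K and 1 leaves room on both sides. *)
pose theta := (K + 3) / (2 * K).
have tK : theta * K = (K + 3) / 2 by rewrite /theta; field; rewrite gt_eqF.
have t0 : 0 < theta by rewrite divr_gt0// ?mulr_gt0//; lra.
have t1 : theta < 1 by rewrite ltr_pdivrMr ?mulr_gt0//; lra.
have tK0 : 0 < theta * K by exact: mulr_gt0.
have kap : 3 / (theta * K) < 1.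
  rewrite ltr_pdivrMr ?mul1r; last exact: mulr_gt0.
  by rewrite tK; lra.
(* Below e0 the factor (1 + theta * e / r) ^+ n.+1 is at most theta * K / 3. *)
pose e0 := (1 - 3 / (theta * K)) * r / (n.+1%:R * theta).
have e00 : 0 < e0 by apply: divr_gt0; apply: mulr_gt0 => //; rewrite subr_gt0.
rewrite div1r muleC lee_pdivrMr// muleC.
apply: (limf_einf_at_right_rescale K0 t0 e00) => e /andP[epos ee0].
have inc := radial_increment_le w_gt0 w_nd w_lc r_gt0 epos
  (introT andP (conj t0 t1)) A_borel A_mass.
have te0 : 0 < theta * e by rewrite mulr_gt0.
set a := (radial_measure n.+1 v (neighborhood e A) - radial_measure n.+1 v A)%E.
have a_ge0 : (0 <= a)%E.
  rewrite /a sube_ge0; first exact: (mass_le_neighborhood w_gt0 w_nd).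
  rewrite A_mass; apply/orP; left; rewrite ge0_fin_numE.
    exact: (mu_ball_fin n w_gt0 w_nd (ltW r_gt0)).
  by apply: integral_ge0 => x _; rewrite lee_fin expR_ge0.
set q := (1 + theta * e / r) ^+ n.+1 in inc.
have q3 : 3 * q <= theta * K.
  have x0 : 0 <= theta * e / r by rewrite divr_ge0// ltW.
  have := exprn_sub1_le n.+1 x0; rewrite -/q => qle.
  have q0 : 0 < q by rewrite exprn_gt0// ltr_wpDr.
  have dx : n.+1%:R * (theta * e / r) <= 1 - 3 / (theta * K).
    move: ee0; rewrite /e0 ltr_pdivlMr; last exact: mulr_gt0.
    move=> ee0.
    rewrite mulrA ler_pdivrMr//; apply: le_trans (ltW ee0).
    by rewrite mulrA [leRHS]mulrC.
  have : (n.+1%:R * (theta * e / r)) * q <= (1 - 3 / (theta * K)) * q.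
    by rewrite ler_pM2r.
  rewrite mulrBl mul1r => h.
  have : 3 / (theta * K) * q <= 1 by lra.
  by rewrite mulrAC (ler_pdivrMr _ _ tK0) mul1r.
apply: (@le_trans _ _ ((3 * q)%:E * a * ((theta * e)^-1)%:E)%E).
  by apply: lee_wpmul2r => //; rewrite lee_fin invr_ge0 ltW.
rewrite -muleA muleCA [leRHS]muleCA; apply: lee_wpmul2l => //.
rewrite -!EFinM lee_fin invfM mulrA; apply: ler_wpM2r.
  by rewrite invr_ge0 ltW.
by rewrite ler_pdivrMr// [leRHS]mulrC.
Qed.
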